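(* Let $\mathbb{F}=\mathbb{C}$ or $\mathbb{R}$ and let $\mathbf{x}_*$ be a semiregular zero of a smooth mapping $\mathbf{f}:\Omega\subset\mathbb{F}^m\to\mathbb{F}^n$ on an open domain $\Omega$. Then there is an open neighborhood $\Delta_*$ of $\mathbf{x}_*$ such that every $\hat{\mathbf{x}}\in\Delta_*\cap\mathbf{f}^{-1}(\mathbf{0})$ is a semiregular zero of $\mathbf{f}$ in the same branch of $\mathbf{x}_*$.
   Context: Smooth mapping: $\mathbf{f}:\Omega\to\mathbb{F}^n$ with $\Omega\subset\mathbb{F}^m$ open is smooth if it has continuous derivatives of second order (case $\mathbb{F}=\mathbb{R}$) or is holomorphic (case $\mathbb{F}=\mathbb{C}$). Its Jacobian is denoted $\mathbf{f}_{\mathbf{x}}$. Zero: $\mathbf{x}_*$ is a zero of $\mathbf{f}$ if $\mathbf{f}(\mathbf{x}_* )=\mathbf{0}$; $\mathbf{f}^{-1}(\mathbf{0})$ is the set of all zeros. A zero is isolated if it is the only zero in some open neighborhood of it. Dimension of a zero: let $\mathbf{x}_*$ be a zero of $\mathbf{f}$. If there is an open neighborhood $\Delta\subset\Omega$ of $\mathbf{x}_*$ in $\mathbb{F}^m$ such that $\Delta\cap\mathbf{f}^{-1}(\mathbf{0})=\phi(\Lambda)$, where $\phi$ is a differentiable injective mapping defined on a connected open set $\Lambda$ in $\mathbb{F}^k$ for a certain $k>0$, with $\phi(\mathbf{z}_* )=\mathbf{x}_*$ for some $\mathbf{z}_*\in\Lambda$ and Jacobian $\phi_{\mathbf{z}}(\mathbf{z}_*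 )$ of rank $k$, then the dimension of $\mathbf{x}_*$ as a zero of $\mathbf{f}$ is $\dim_{\mathbf{f}}(\mathbf{x}_* ):=k$. An isolated zero has dimension $0$. Otherwise the dimension is not defined. Semiregular zero: a zero $\mathbf{x}_*$ is semiregular if $\dim_{\mathbf{f}}(\mathbf{x}_* )$ is well-defined and equal to the nullity of $\mathbf{f}_{\mathbf{x}}(\mathbf{x}_* )$, i.e. $\dim_{\mathbf{f}}(\mathbf{x}_* )+\mathrm{rank}(\mathbf{f}_{\mathbf{x}}(\mathbf{x}_* ))=m$. Same branch: with $\phi,\Lambda,\mathbf{z}_*,k$ as in the definition of the dimension of $\mathbf{x}_*$ and $\Lambda_*\subset\Lambda$ an open neighborhood of $\mathbf{z}_*$ on which $\mathrm{rank}(\phi_{\mathbf{z}}(\mathbf{z}))\equiv k$, every $\mathbf{x}\in\phi(\Lambda_* )$ is in the same branch of zeros as $\mathbf{x}_*$; and if $\tilde{\mathbf{x}}$ is in the same branch as $\mathbf{x}_*$, then every zero in the same branch as $\tilde{\mathbf{x}}$ is in the same branch as $\mathbf{x}_*$. An isolated zero is in the same branch only as itself. *)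

(* Defs.v *)
From HB Require Import structures.
From mathcomp Require Import all_boot all_order all_algebra.
From mathcomp Require Import all_classical all_reals all_analysis.
From mathcomp Require Export complex.
Set Implicit Arguments.
Unset Strict Implicit.
Unset Printing Implicit Defensive.
Import Order.TTheory GRing.Theory Num.Theory.
Import numFieldNormedType.Exports.
Local Open Scope classical_set_scope.
Local Open Scope ring_scope.

(* Vectors of K^m are row vectors, so 'J f x : 'M[K]_(m, n) is the transpose of
   the usual Jacobian matrix; only its rank is used.  A map defined on an open
   set is a total function whose values outside that set are never relevant. *)

Variant scalar_kind := RealScalars | ComplexScalars.

Definition scalars (R : realType) (s : scalar_kind) : numFieldType :=
  match s with
  | RealScalars => R
  | ComplexScalars => R[i]
  end.

Section Zeros.
Context {K : numFieldType} {m n : nat}.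
Implicit Types (Omega : set 'rV[K]_m) (f : 'rV[K]_m -> 'rV[K]_n).
Implicit Types x y : 'rV[K]_m.

Definition C2_on Omega f : Prop := forall x, Omega x ->
  [/\ differentiable f x,
      differentiable (jacobian f) x &
      forall v, {for x, continuous (fun y => 'd (jacobian f) y v)}].

Definition zeros Omega f : set 'rV[K]_m := [set x | Omega x /\ f x = 0].

Definition isolated_zero Omega f x : Prop :=
  exists Delta : set 'rV[K]_m,
    [/\ open Delta, Delta x & Delta `&` zeros Omega f = [set x]].

Record zero_chart Omega f x (k : nat) (Lambda : set 'rV[K]_k)
    (phi : 'rV[K]_k -> 'rV[K]_m) (z : 'rV[K]_k) : Prop := ZeroChart {
  chart_dim_gt0 : (0 < k)%N;
  chart_image : exists Delta : set 'rV[K]_m,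
    [/\ open Delta, Delta `<=` Omega, Delta x &
        Delta `&` zeros Omega f = phi @` Lambda];
  chart_open : open Lambda;
  chart_connected : connected Lambda;
  chart_differentiable : forall w, Lambda w -> differentiable phi w;
  chart_inj : set_inj Lambda phi;
  chart_base : Lambda z;
  chart_baseE : phi z = x;
  chart_rank : \rank ('J phi z) = k
}.

(* "The dimension of x as a zero of f is defined and equal to k"; k is unique
   when it exists. *)
Definition zero_dim Omega f x (k : nat) : Prop :=
  (k = 0%N /\ isolated_zero Omega f x) \/
  (exists (Lambda : set 'rV[K]_k) (phi : 'rV[K]_k -> 'rV[K]_m) (z : 'rV[K]_k),
     zero_chart Omega f x Lambda phi z).

Definition semiregular_zero Omega f x : Prop :=
  zeros Omega f x /\
  exists k : nat, zero_dim Omega f x k /\ (k + \rank ('J f x))%N = m.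

(* [same_branch Omega f x y]: y is in the same branch of zeros as x. *)
Inductive same_branch Omega f : 'rV[K]_m -> 'rV[K]_m -> Prop :=
| same_branch_chart x y (k : nat) (Lambda Lambda_x : set 'rV[K]_k)
    (phi : 'rV[K]_k -> 'rV[K]_m) (z : 'rV[K]_k) :
    zero_chart Omega f x Lambda phi z ->
    open Lambda_x -> Lambda_x `<=` Lambda -> Lambda_x z ->
    (forall w, Lambda_x w -> \rank ('J phi w) = k) ->
    (phi @` Lambda_x) y ->
    same_branch Omega f x y
| same_branch_isolated x :
    isolated_zero Omega f x -> same_branch Omega f x x
| same_branch_trans x y t :
    same_branch Omega f x y -> same_branch Omega f y t ->
    same_branch Omega f x t.

End Zeros.

(* Over the complex scalars [differentiable] is complex differentiability, so
   the second clause says that f is holomorphic on Omega. *)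
Definition smooth_on (R : realType) (s : scalar_kind) (m n : nat)
    (Omega : set 'rV[scalars R s]_m)
    (f : 'rV[scalars R s]_m -> 'rV[scalars R s]_n) : Prop :=
  match s with
  | RealScalars => C2_on Omega f
  | ComplexScalars => forall x, Omega x -> differentiable f x
  end.

(* Main.v *)
(* Let x be a semiregular zero of dimension k > 0 with chart phi, and put
   A = 'J f x, B = 'J phi z.  The rows of B span the kernel of A, so for a right
   inverse P of B the map v |-> (v P, v A) is injective.  As f is strictly
   differentiable at x, the zeros of f near x are therefore bi-Lipschitz
   determined by their coordinates u = y P.  The map w |-> phi(w) P has derivative
   the identity at z, hence it covers a neighbourhood of x P: since phi is only
   differentiable, this rests on the Poincare-Miranda theorem and not on an
   inverse function theorem.  So every u near x P is the coordinate of a unique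
   zero psi(u) near x; the map psi is differentiable of constant rank k and is a
   chart of the zero set at each of its points, and
   rank ('J f (psi u)) = m - k.
     Over the reals strict differentiability follows from C^2 by the mean value
   theorem.  Over the complex numbers the continuity of the derivative is derived
   from a Cauchy estimate, itself obtained from Goursat's lemma applied to
   (g(e^w) - g(0)) / e^w on rectangles of height 2 pi. *)

Require Import Defs.
From HB Require Import structures.
From mathcomp Require Import all_boot all_order all_algebra.
From mathcomp Require Import all_classical all_reals all_analysis.
From mathcomp Require Import all_fingroup zify ring lra.
Import Order.TTheory GRing.Theory Num.Def Num.Theory.
Import numFieldNormedType.Exports.
Set Implicit Arguments.
Unset Strict Implicit.
Unset Printing Implicit Defensive.
Local Open Scope ring_scope.

(** * The Poincare-Miranda theorem *)

Section ChainSum.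
Context {n : nat} {V : finZmodType} (e : 'I_n -> V).
Implicit Types (a : V -> 'I_n -> int) (b : V -> int) (s : 'S_n).

(* [chain_sum A] is the evaluation of the cup product of the 1-cochains [A t] on
   the fundamental cycle of the torus [V], triangulated by the Kuhn simplices
   q, q + e (s 0), q + e (s 0) + e (s 1), ...; [a v i] is the value of the cochain
   [a] on the edge from [v] to [v + e i]. *)
Definition closed_cochain a :=
  forall v i j, a v i + a (v + e i) j = a v j + a (v + e j) i.

Definition coboundary b : V -> 'I_n -> int := fun v i => b (v + e i) - b v.

Definition chain_vertex q s (t : nat) : V := q + \sum_(r < n | (r < t)%N) e (s r).

Definition chain_sum (A : 'I_n -> V -> 'I_n -> int) : int :=
  \sum_(q : V) \sum_(s : 'S_n)
    (-1) ^+ s * \prod_(t < n) A t (chain_vertex q s t) (s t).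

Lemma coboundary_closed b : closed_cochain (coboundary b).
Proof. by move=> v i j; rewrite /coboundary (addrAC v (e j)); ring. Qed.

(** Multiplication by the transposition of [i] and [j] reverses every sign and keeps [G], so the sum
    equals its own opposite. *)
Lemma signed_sum_swap (i j : 'I_n) (G : 'S_n -> int) : i != j ->
  (forall s, G (tperm i j * s)%g = G s) -> \sum_(s : 'S_n) (-1) ^+ s * G s = 0.
Proof.
move=> ij HG; set S := LHS.
suff : S = - S by lia.
rewrite {1}/S (reindex_inj (mulgI (tperm i j))) /= /S -sumrN.
apply: eq_bigr => s _; rewrite HG odd_permM odd_tperm ij /= -mulNr.
by case: (odd_perm s); rewrite /= ?expr0 ?expr1 ?opprK.
Qed.

(** A cup product of closed cochains with one exact factor is itself exact, so it vanishes on a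
    cycle. The proof is the corresponding summation by parts. *)
Lemma chain_sum_exact (A : 'I_n -> V -> 'I_n -> int) (k : 'I_n) b :
  (forall t, t != k -> closed_cochain (A t)) ->
  (forall v i, A k v i = coboundary b v i) -> chain_sum A = 0.
Proof.
move=> Acl Ak.
(* [U p s q] skips the direction [s k] before step [p]: [U k - U k.+1] is the
   term to be summed, [U 0] and [U n] differ by a translation of [q], and for
   [p != k] closedness makes [U p - U p.+1] symmetric under swapping [s p] and
   [s k]. *)
pose B t v i := if t == k then b v else A t v i.
pose u q s (t : nat) := q + \sum_(r < n | (r < t)%N && (r != k)) e (s r).
pose U (p : nat) s q := \prod_(t < n) B t (u q s t + e (s k) *+ (p <= t)%N) (s t).
(* The true simplex has moved in direction [s k] exactly at the vertices after step [k]. *)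
have uk q s (t : nat) : chain_vertex q s t = u q s t + e (s k) *+ (k < t)%N.
  rewrite /chain_vertex /u; case: ltnP => kt.
    by rewrite (bigD1 k) //= mulr1n addrAC -addrA.
  rewrite mulr0n addr0; congr (_ + _); apply: eq_bigl => r.
  by case: eqP => [->|]; rewrite ?andbT // ltnNge kt.
have -> : chain_sum A = \sum_q \sum_(s : 'S_n) (-1) ^+ s * (U k s q - U k.+1 s q).
  apply: eq_bigr => q _; apply: eq_bigr => s _; congr (_ * _).
  rewrite /U (bigD1 k) //= [X in _ = X - _](bigD1 k) //= [X in _ = _ - X](bigD1 k) //=.
  rewrite uk !ltnn leqnn !mulr0n mulr1n addr0 Ak /B eqxx /coboundary.
  have E (p : nat) : (p = k \/ p = k.+1) ->
      \prod_(i < n | i != k) (if i == k then b (u q s i + e (s k) *+ (p <= i)%N)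
                             else A i (u q s i + e (s k) *+ (p <= i)%N) (s i)) =
      \prod_(i < n | i != k) A i (chain_vertex q s i) (s i).
    move=> Hp; apply: eq_bigr => i ik; rewrite (negbTE ik) uk.
    suff -> : (p <= i)%N = (k < i)%N by [].
    by case: Hp => -> //; rewrite leq_eqVlt eq_sym (negbTE (ik : (i : nat) != k)).
  by rewrite !E ?mulrBl; auto.
have step (p : 'I_n) : p != k -> \sum_q \sum_(s : 'S_n) (-1) ^+ s * (U p s q - U p.+1 s q) = 0.
  move=> pk; rewrite big1 // => q _; apply: (@signed_sum_swap p k) => // s.
  set s' := (_ * s)%g.
  have s'p : s' p = s k by rewrite permM tpermL.
  have s'k : s' k = s p by rewrite permM tpermR.
  have s'o t : t != p -> t != k -> s' t = s t.
    by move=> tp tk; rewrite permM tpermD // eq_sym.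
  have us (t : nat) : (t <= p)%N -> u q s' t = u q s t.
    move=> tp; congr (_ + _); apply: eq_bigr => r /andP[rt rk].
    by rewrite s'o // neq_ltn (leq_trans rt tp).
  have us' (t : nat) : (p < t)%N -> u q s' t + e (s' k) = u q s t + e (s k).
    move=> pt; rewrite /u -!addrA; congr (_ + _).
    rewrite (bigD1 p) /= ?pt // [in RHS](bigD1 p) /= ?pt // s'p s'k.
    under eq_bigr => r /andP[/andP[_ rk] rp] do rewrite s'o //.
    by rewrite addrAC [in RHS]addrAC [e (s k) + _]addrC.
  rewrite /U !(bigD1 (P := xpredT) p) //= !s'p !s'k !leqnn !ltnn !mulr0n !mulr1n !addr0 us //.
  rewrite /B (negbTE pk).
  set X' := \prod_(i < n | i != p) _; set Y' := \prod_(i < n | i != p) _.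
  set X := \prod_(i < n | i != p) _; set Y := \prod_(i < n | i != p) _.
  have XY : Y = X.
    apply: eq_bigr => i ip.
    by rewrite [(p <= i)%N]leq_eqVlt [(p : nat) == i]eq_sym (negbTE (ip : (i : nat) != p)).
  have XY' : Y' = X'.
    apply: eq_bigr => i ip.
    by rewrite [(p <= i)%N]leq_eqVlt [(p : nat) == i]eq_sym (negbTE (ip : (i : nat) != p)).
  have XX : X' = X.
    apply: eq_bigr => i ip.
    have E : u q s' i + e (s p) *+ (p <= i)%N = u q s i + e (s k) *+ (p <= i)%N.
      case: leqP => pi.
        by rewrite !mulr1n -us' ?s'k // ltn_neqAle pi eq_sym (ip : (i : nat) != p).
      by rewrite !mulr0n !addr0 us // ltnW.
    by rewrite E; case: (altP eqP) => // ik; rewrite s'o.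
  rewrite XY XY' XX -!mulrBl; congr (_ * _).
  have := Acl p pk (u q s p) (s p) (s k); by do 4! move: (A p _ _) => ?; lia.
pose T (p : nat) := \sum_q \sum_(s : 'S_n) (-1) ^+ s * U p s q.
have TB p : T p - T p.+1 = \sum_q \sum_(s : 'S_n) (-1) ^+ s * (U p s q - U p.+1 s q).
  rewrite /T -sumrB; apply: eq_bigr => q _; rewrite -sumrB; apply: eq_bigr => s _.
  by rewrite mulrBr.
have T0n : T 0%N = T n.
  rewrite /T exchange_big /= [RHS]exchange_big /=; apply: eq_bigr => s _.
  rewrite [RHS](reindex_inj (addrI (e (s k)))) /=; apply: eq_bigr => q _; congr (_ * _).
  apply: eq_bigr => t _; rewrite [(n <= t)%N]leqNgt ltn_ord /= mulr0n addr0 mulr1n; congr (B _ _ _).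
  by rewrite /u addrAC [_ + q]addrC.
have : \sum_(p < n) (T p - T p.+1) = 0.
  rewrite -(big_mkord xpredT (fun p => T p - T p.+1)).
  transitivity (- \sum_(0 <= p < n) (T p.+1 - T p)).
    by rewrite -sumrN; apply: eq_bigr => p _; rewrite opprB.
  by rewrite telescope_sumr // T0n subrr oppr0.
rewrite (bigD1 k) //= big1 ?addr0 => [|p pk]; last by rewrite TB step.
by rewrite TB.
Qed.

(** The factors are exchanged one at a time: [M p] uses [W] in its first [p] places, and passing
    from [M p] to [M p.+1] changes the sum by a chain sum with an exact factor in place [p]. *)
Lemma chain_sum_cohomologous (A W : 'I_n -> V -> 'I_n -> int) (b : 'I_n -> V -> int) :
  (forall t, closed_cochain (W t)) ->
  (forall t v i, A t v i = coboundary (b t) v i + W t v i) ->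
  chain_sum A = chain_sum W.
Proof.
move=> Wcl AW.
have Acl t : closed_cochain (A t).
  move=> v i j; have := Wcl t v i j; have := coboundary_closed (b t) v i j.
  rewrite !AW; do 4! move: (coboundary _ _ _) => ?; do 4! move: (W _ _ _) => ?; lia.
pose M (p : nat) (t : 'I_n) := if (t < p)%N then W t else A t.
have E p : (p <= n)%N -> chain_sum (M p) = chain_sum A.
  elim: p => [_|p IH pn]; first by [].
  rewrite -(IH (ltnW pn)); apply/eqP; rewrite eq_sym -subr_eq0; apply/eqP.
  pose P := Ordinal pn.
  rewrite -(@chain_sum_exact (fun t => if t == P then coboundary (b P) else M p t) P (b P)).
  - rewrite /chain_sum -sumrB; apply: eq_bigr => q _; rewrite -sumrB; apply: eq_bigr => s _.
    rewrite -mulrBr; congr (_ * _).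
    rewrite !(bigD1 (P := xpredT) P) //= eqxx /M /= ltnn ltnSn AW.
    have R t : t != P -> (t < p.+1)%N = (t < p)%N.
      by move=> tP; rewrite ltnS leq_eqVlt (negbTE (tP : (t : nat) != p)).
    pose F (t : 'I_n) := (if (t < p)%N then W t else A t) (chain_vertex q s t) (s t).
    rewrite [X in _ - _ * X = _](eq_bigr F) => [|t tP]; last by rewrite R.
    rewrite [X in _ = _ * X](eq_bigr F) => [|t tP]; last by rewrite (negbTE tP).
    by rewrite -mulrBl addrK.
  - by move=> t tP; rewrite (negbTE tP) /M; case: ifP.
  - by move=> v i; rewrite eqxx.
rewrite -(E n) //; apply: eq_bigr => q _; apply: eq_bigr => s _; congr (_ * _).
by apply: eq_bigr => t _; rewrite /M ltn_ord.
Qed.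

End ChainSum.

Lemma chain_vertex_coord n M (q : 'rV['I_M.+2]_n) (s : 'S_n) (t : nat) (i : 'I_n) :
  chain_vertex (fun i => delta_mx 0 i) q s t 0 i
  = q 0 i + (((s^-1)%g i < t)%N)%:R.
Proof.
rewrite mxE summxE; congr (_ + _).
under eq_bigr => r _ do rewrite mxE eqxx /=.
rewrite (bigID (fun r => r == (s^-1)%g i)) /= [X in _ + X]big1 ?addr0 => [|r /andP[_ /negbTE ri]].
  case: ltnP => st.
    rewrite (big_pred1 ((s^-1)%g i)) => [|r]; first by rewrite permKV eqxx.
    rewrite /=; by case: (r =P _) => [->|]; rewrite ?andbF // st.
  rewrite big_pred0 // => r; case: (r =P _) => [->|]; rewrite ?andbF //.
  by rewrite ltnNge st.
by rewrite -(inj_eq (@perm_inj _ (s^-1)%g)) permK eq_sym ri.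
Qed.

(** The grid is closed up to a torus. There [A t] is cohomologous to [W t], which represents the
    class of the [t]-th coordinate, and the product of these classes evaluates to 1. Hence some Kuhn
    simplex has all factors nonzero, which forces the label [b t] to change along its edge number
    [t]. *)
Lemma discrete_poincare_miranda n M (b : 'I_n -> 'rV['I_M.+2]_n -> bool) :
  (forall i (v : 'rV['I_M.+2]_n), v 0 i = 0 -> b i v = false) ->
  (forall i (v : 'rV['I_M.+2]_n), v 0 i = ord_max -> b i v = true) ->
  exists q : 'rV['I_M.+2]_n, forall i, exists v w : 'rV['I_M.+2]_n,
    [/\ forall j, (q 0%R j <= v 0%R j <= (q 0%R j).+1)%N,
        forall j, (q 0%R j <= w 0%R j <= (q 0%R j).+1)%N,
        b i v = false & b i w = true].
Proof.
move=> b0 bM.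
pose e (i : 'I_n) : 'rV['I_M.+2]_n := delta_mx 0 i.
(* The coboundary of [b t] corrected by the indicator of the edges in direction
   [t] that wrap around the torus: the result vanishes on these edges. *)
pose W (t : 'I_n) (v : 'rV['I_M.+2]_n) (i : 'I_n) : int :=
  ((i == t) && (v 0 t == ord_max))%:R.
pose B (t : 'I_n) (v : 'rV['I_M.+2]_n) : int := (b t v)%:R.
pose A t v i := coboundary e (B t) v i + W t v i.
have Wcl t : closed_cochain e (W t).
  move=> v i j; rewrite /W !mxE eqxx /= [t == i]eq_sym [t == j]eq_sym.
  by case: (i == t); case: (j == t); rewrite /= ?addr0 ?add0r.
have max1 : (ord_max : 'I_M.+2) + 1 = 0 by apply/val_inj; rewrite /= addn1 modnn.
(* Only the simplex that starts at the corner with all coordinates [ord_max] and has [s = 1]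
   contributes: a nonzero factor needs [s t = t], and then coordinate [t] has not yet moved at
   vertex [t]. *)
have sumW : chain_sum e W = 1.
  rewrite /chain_sum (bigD1 (const_mx ord_max)) //= (bigD1 1%g) //=.
  rewrite odd_perm1 expr0 mul1r big1 => [|t _]; last first.
    by rewrite /W chain_vertex_coord invg1 !perm1 ltnn addr0 mxE !eqxx.
  have Z q (s : 'S_n) : (s != 1%g) || (q != const_mx ord_max) ->
      \prod_(t < n) W t (chain_vertex e q s t) (s t) = 0.
    move=> sq; apply/eqP/prodf_eq0.
    have [s1|s1] := eqVneq s 1%g; last first.
      have /existsP[t st] : [exists t, s t != t].
        rewrite -negb_forall; apply: contra s1 => /forallP H.
        by apply/eqP/permP => t; rewrite perm1; apply/eqP.
      by exists t; rewrite // /W (negbTE st).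
    move: sq; rewrite {}s1 eqxx /= => qM.
    have /existsP[t qt] : [exists t, q 0 t != ord_max].
      rewrite -negb_forall; apply: contra qM => /forallP H.
      by apply/eqP/rowP => t; rewrite mxE; apply/eqP.
    by exists t; rewrite // /W chain_vertex_coord invg1 !perm1 ltnn addr0 (negbTE qt) andbF.
  rewrite big1 => [|s s1]; last by rewrite Z ?mulr0 // s1.
  rewrite addr0 big1 ?addr0 // => q qM; rewrite big1 // => s _.
  by rewrite Z ?mulr0 // qM orbT.
have sumA : chain_sum e A = 1 by rewrite (chain_sum_cohomologous Wcl (b := B)).
have /existsP[q /existsP[s nz]] : [exists q, exists s : 'S_n,
    \prod_(t < n) A t (chain_vertex e q s t) (s t) != 0].
  apply: contraT; rewrite negb_exists => /forallP H.
  move: sumA; rewrite /chain_sum big1 => [//|q _]; rewrite big1 // => s _.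
  by move: (H q); rewrite negb_exists => /forallP/(_ s)/negPn/eqP ->; rewrite mulr0.
have {}nz t : A t (chain_vertex e q s t) (s t) != 0.
  by apply: contra nz => /eqP At; apply/prodf_eq0; exists t; rewrite ?At ?eqxx.
(* The simplex does not wrap around. If [q 0 t] were maximal, edge [t] would either wrap in
   direction [t], where the correction cancels the coboundary, or stay inside one of the two faces,
   where the label is constant. *)
have qM t : q 0 t != ord_max.
  apply: contra (nz t) => /eqP qt; apply/eqP.
  rewrite /A /coboundary /W /B.
  set v : 'rV['I_M.+2]_n := chain_vertex _ _ _ _.
  have vE : v 0 t = q 0 t + (((s^-1)%g t < t)%N)%:R by rewrite chain_vertex_coord.
  case: (eqVneq (s t) t) => st.
    have st' : (s^-1)%g t = t by rewrite -{1}st permK.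
    rewrite st' ltnn addr0 qt in vE.
    by rewrite vE eqxx st (bM t v) // (b0 t (v + e t)) // mxE vE mxE !eqxx.
  have ve : (v + e (s t)) 0 t = v 0 t by rewrite mxE [e _ _ _]mxE eqxx eq_sym (negbTE st) addr0.
  rewrite /= addr0; rewrite qt in vE; move: vE; case: ltnP => _; rewrite ?max1 ?addr0 => vE.
    by rewrite !(b0 t) ?ve.
  by rewrite !(bM t) ?ve.
have cube t j : (q 0%R j <= chain_vertex e q s t 0%R j <= (q 0%R j).+1)%N.
  rewrite chain_vertex_coord; case: ltnP => _; last by rewrite addr0 leqnn leqnSn.
  have qj : (q 0%R j < M.+1)%N.
    have := qM j; have := ltn_ord (q 0 j); rewrite ltnS leq_eqVlt => /orP[/eqP E|//].
    by case/eqP; apply/val_inj.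
  by rewrite /= modn_small ?addn1 ?leqnn ?leqnSn // modn_small ?addn1.
exists q => i.
have vS : chain_vertex e q s i.+1 = chain_vertex e q s i + e (s i).
  rewrite /chain_vertex (bigD1 i) //= addrA addrAC; congr (_ + _ + _).
  by apply: eq_bigl => r; rewrite ltnS ltn_neqAle andbC.
have Wi : W i (chain_vertex e q s i) (s i) = 0.
  rewrite /W; case: (eqVneq (s i) i) => //= si.
  have si' : (s^-1)%g i = i by rewrite -{1}si permK.
  by rewrite chain_vertex_coord si' ltnn addr0 (negbTE (qM i)).
have := nz i; rewrite /A Wi addr0 /coboundary -vS /B.
case E1 : (b i _); case E2 : (b i _) => // _.
  by exists (chain_vertex e q s i), (chain_vertex e q s i.+1).
by exists (chain_vertex e q s i.+1), (chain_vertex e q s i).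
Qed.

Local Open Scope classical_set_scope.
Local Open Scope ring_scope.

Lemma mx_norm_leP (K : numFieldType) m n (A : 'M[K]_(m, n)) (e : K) : 0 <= e ->
  (`|A| <= e <-> forall i j, `|A i j| <= e).
Proof.
move=> e0; split=> [Ae i j|Ae].
  apply: le_trans Ae; rewrite [leRHS]/normr /= mx_normE -[leLHS]nngE num_le.
  exact: (le_bigmax _ (fun i => `|A i.1 i.2|%:nng) (i, j)).
move/nonnegP: e0 Ae => [{}e] Ae; rewrite [leLHS]/normr /= mx_normE num_le.
apply/bigmax_leP; split; [by rewrite -num_le /=|].
by case=> i j _; rewrite -num_le /=.
Qed.

Lemma mx_coord_le (K : numFieldType) m n (A : 'M[K]_(m, n)) i j : `|A i j| <= `|A|.
Proof. by move: i j; apply/mx_norm_leP. Qed.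

(** * Zeros of continuous maps on a cube *)

Section PoincareMiranda.
Context {R : realType} {n : nat}.
Implicit Types (x y : 'rV[R]_n) (g : 'rV[R]_n -> 'rV[R]_n).

Lemma poincare_miranda_mesh g (r e : R) : 0 < r -> 0 < e ->
  (forall x i, `|x| <= r -> x 0 i = - r -> g x 0 i <= 0) ->
  (forall x i, `|x| <= r -> x 0 i = r -> 0 <= g x 0 i) ->
  exists2 p, `|p| <= r & forall i, exists x y,
    [/\ `|x| <= r, `|x - p| <= e & g x 0 i <= 0] /\
    [/\ `|y| <= r, `|y - p| <= e & 0 <= g y 0 i].
Proof.
move=> r0 e0 glo ghi.
(* [M.+1] exceeds [2 * r / e], so the mesh [h] is at most [e]; the indices 0 and [M.+1] are sent to
   the faces [- r] and [r]. *)
pose M := Num.truncn (2 * r / e).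
pose h : R := 2 * r / M.+1%:R.
have M0 : 0 < M.+1%:R :> R by rewrite ltr0n.
have h0 : 0 < h by rewrite divr_gt0 // mulr_gt0.
have he : h <= e.
  have := truncnS_gt (2 * r / e); rewrite -/M ltr_pdivrMr // => H.
  by rewrite ler_pdivrMr // [e * _]mulrC ltW.
pose X (v : 'rV['I_M.+2]_n) : 'rV[R]_n := \row_j (- r + h * (v 0 j : nat)%:R).
have hM : h * M.+1%:R = 2 * r by rewrite /h divfK // gt_eqF.
have Xr v : `|X v| <= r.
  apply/mx_norm_leP; [exact: ltW|move=> i j; rewrite mxE ler_norml].
  have : (v 0 j : nat)%:R <= M.+1%:R :> R by rewrite ler_nat -ltnS ltn_ord.
  move=> /(ler_wpM2l (ltW h0)); rewrite hM => H1.
  have H2 : 0 <= h * (v 0 j : nat)%:R by rewrite mulr_ge0 // ltW.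
  by apply/andP; split; lra.
(* The sign label is overridden on the two faces, since [g] may vanish there while the discrete
   statement needs fixed labels. *)
pose b i (v : 'rV['I_M.+2]_n) := (v 0 i != 0) && ((v 0 i == ord_max) || (0 < g (X v) 0 i)).
have [||q Hq] := @discrete_poincare_miranda n M b.
- by move=> i v vi; rewrite /b vi eqxx.
- by move=> i v vi; rewrite /b vi eqxx.
have near (v : 'rV['I_M.+2]_n) : (forall j, (q 0%R j <= v 0%R j <= (q 0%R j).+1)%N) -> `|X v - X q| <= e.
  move=> vq; apply/mx_norm_leP; [exact: ltW|move=> i j; rewrite !mxE].
  have /andP[] := vq j; rewrite -!(ler_nat R) -[(_.+1)%:R]natr1 => H1 H2.
  rewrite (_ : _ - _ = h * ((v 0 j : nat)%:R - (q 0 j : nat)%:R)); last by ring.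
  rewrite normrM (gtr0_norm h0) ger0_norm ?subr_ge0 //.
  apply: le_trans he; rewrite ler_piMr ?(ltW h0) //; lra.
exists (X q) => // i; have [v [w [qv qw bv bw]]] := Hq i.
exists (X v), (X w); split; split; rewrite ?Xr ?near //.
  move: bv; rewrite /b; case: eqVneq => /= [v0 _|_].
    by apply: glo => //; rewrite mxE v0 mulr0 addr0.
  by case: eqVneq => //= _ /negbT; rewrite -leNgt.
move: bw; rewrite /b; case: eqVneq => //= _; case: eqVneq => /= [v0 _|_ /ltW //].
by apply: ghi => //; rewrite mxE v0 hM; lra.
Qed.

(** By compactness the centres found for the meshes [k.+1%:R^-1] have a cluster point. A nonzero
    coordinate of [g] there would keep its sign nearby, against the points of both weak signs around
    each centre. *)
Lemma poincare_miranda g (r : R) : 0 < r ->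
  (forall x, `|x| <= r -> {for x, continuous g}) ->
  (forall x i, `|x| <= r -> x 0 i = - r -> g x 0 i <= 0) ->
  (forall x i, `|x| <= r -> x 0 i = r -> 0 <= g x 0 i) ->
  exists2 x, `|x| <= r & g x = 0.
Proof.
move=> r0 gc glo ghi.
have e0 k : 0 < (k.+1%:R^-1 : R) by rewrite invr_gt0 ltr0n.
have /choice[p Hp] : forall k : nat, exists p, `|p| <= r /\ forall i, exists x y,
    [/\ `|x| <= r, `|x - p| <= k.+1%:R^-1 & g x 0 i <= 0] /\
    [/\ `|y| <= r, `|y - p| <= k.+1%:R^-1 & 0 <= g y 0 i].
  by move=> k; have [p ? ?] := poincare_miranda_mesh r0 (e0 k) glo ghi; exists p.
have cB : compact [set x : 'rV[R]_n | `|x| <= r].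
  rewrite (_ : [set _ | _] = [set v : 'rV[R]_n | forall i, `[- r, r]%classic (v ord0 i)]).
    by apply: (@rV_compact _ _ (fun=> `[- r, r]%classic)) => _; exact: segment_compact.
  apply/seteqP; split=> x /= xr.
    by move=> i; rewrite in_itv /= -ler_norml; apply: le_trans xr; exact: mx_coord_le.
  apply/mx_norm_leP; [exact: ltW|move=> i j; rewrite ord1].
  by have := xr j; rewrite in_itv /= -ler_norml.
have [x [xr xcl]] : [set x : 'rV[R]_n | `|x| <= r] `&` cluster (p @ \oo) !=set0.
  by apply: cB; apply: (@filterS _ \oo _ setT) => [k _|]; [have [] := Hp k|exact: filterT].
(* Half of the radius is spent on bringing [p k] close to [x], the other half on the distance from
   [p k] to the sampled points. *)
have key (P : set 'rV[R]_n) : nbhs x P ->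
    exists k, forall y, `|y - p k| <= k.+1%:R^-1 -> P y.
  move=> /nbhs_ballP[e /= e1 eP].
  have A : (p @ \oo) [set p k | k in [set k | k.+1%:R^-1 < e / 2]].
    have e2 : 0 < e / 2 by rewrite divr_gt0.
    by apply: filterS (near_infty_natSinv_lt (PosNum e2)) => k ke; exists k.
  have B : nbhs x (ball x (e / 2)) by apply: nbhsx_ballx; rewrite divr_gt0.
  have [_ [[k /= ke <-] xp]] := xcl _ _ A B.
  exists k => y yp; apply: eP; rewrite [e]splitr; apply: ball_triangle xp _.
  by rewrite -ball_normE /= distrC; exact: le_lt_trans ke.
exists x => //; apply/rowP => i; rewrite [in RHS]mxE.
have gi : {for x, continuous (fun y => g y 0 i)}.
  apply: (@continuous_comp _ _ _ g (fun M : 'rV[R]_n => M 0 i)); first exact: gc.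
  exact: coord_continuous.
have [gx|gx|//] := ltgtP (g x 0 i) 0.
  have [k Hk] := key _ (gi _ (lt_nbhsl gx)).
  have [_ /(_ i)[_ [y [_ [yr yp gy]]]]] := Hp k.
  by have /= := Hk y yp; rewrite ltNge gy.
have [k Hk] := key _ (gi _ (lt_nbhsr gx)).
have [_ /(_ i)[y [_ [[yr yp gy] _]]]] := Hp k.
by have /= := Hk y yp; rewrite ltNge gy.
Qed.

(** On the faces [x 0 i = - r] and [x 0 i = r] the two errors of size [r / 2] cannot outweigh [r],
    so [g x - y] has the signs required by [poincare_miranda]. *)
Lemma near_identity_onto g (r : R) : 0 < r ->
  (forall x, `|x| <= r -> {for x, continuous g}) ->
  (forall x, `|x| <= r -> `|g x - x| <= r / 2) ->
  forall y, `|y| <= r / 2 -> exists2 x, `|x| <= r & g x = y.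
Proof.
move=> r0 gc gid y yr.
have [||||x xr /subr0_eq gx] := @poincare_miranda (fun x => g x - y) r; last by exists x.
- by [].
- by move=> x xr; apply: continuousB; [exact: gc|exact: cst_continuous].
- move=> x i xr xi; rewrite !mxE.
  have := le_trans (mx_coord_le (g x - x) 0 i) (gid x xr).
  have := le_trans (mx_coord_le y 0 i) yr.
  rewrite !mxE xi !ler_norml; lra.
- move=> x i xr xi; rewrite !mxE.
  have := le_trans (mx_coord_le (g x - x) 0 i) (gid x xr).
  have := le_trans (mx_coord_le y 0 i) yr.
  rewrite !mxE xi !ler_norml; lra.
Qed.

End PoincareMiranda.

(** * Differentials and Jacobian matrices *)

Lemma differentiable_near_le (K : numFieldType) (V W : normedModType K)
    (f : V -> W) (x : V) (e : K) : differentiable f x -> 0 < e ->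
  \forall y \near x, `|f y - f x - 'd f x (y - x)| <= e * `|y - x|.
Proof.
move=> /diffP[_ fx] e0; have /eqaddoP/(_ e e0) := funext fx.
apply: filterS => y /=; rewrite lim_id //.
by rewrite -[X in `|X|]/(f y - (f x + 'd f x (y - x))) opprD addrA.
Qed.

Lemma near_le_differentiable (K : numFieldType) (V W : normedModType K)
    (f : V -> W) (x : V) (L : {linear V -> W}) : continuous L ->
  (forall e : K, 0 < e -> \forall y \near x, `|f y - f x - L (y - x)| <= e * `|y - x|) ->
  differentiable f x /\ 'd f x = L :> (V -> W).
Proof.
move=> Lc fL.
have E : f \o shift x = cst (f x) + L +o_ 0 id.
  apply/eqaddoP => e e0; have := fL e e0; rewrite (near_shift 0).
  apply: filterS => y; rewrite subr0 /= addrK.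
  by rewrite -[X in _ -> `|X| <= _]/(f (y + x) - (f x + L y)) opprD addrA.
have dL := diff_unique Lc E; split=> //.
by apply/diff_locallyP; rewrite dL; split.
Qed.

Section Matrices.
Context {K : numFieldType}.

Lemma mulmx_norm_le m n p (A : 'M[K]_(p, m)) (B : 'M[K]_(m, n)) :
  `|A *m B| <= m%:R * `|A| * `|B|.
Proof.
apply/mx_norm_leP => [|i j]; first by rewrite !mulr_ge0.
rewrite mxE; apply: le_trans (ler_norm_sum _ _ _) _.
rewrite -mulrA mulr_natl -[X in _ *+ X]card_ord -sumr_const.
by apply: ler_sum => k _; rewrite normrM ler_pM ?mx_coord_le.
Qed.

Lemma mulmx_lipschitz m n (A : 'M[K]_(m, n)) :
  exists2 C : K, 0 < C & forall p (v : 'M[K]_(p, m)), `|v *m A| <= C * `|v|.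
Proof.
exists (m%:R * `|A| + 1) => [|p v]; first by rewrite ltr_wpDl ?mulr_ge0.
apply: le_trans (mulmx_norm_le _ _) _.
by rewrite mulrAC ler_wpM2r // lerDl.
Qed.

Lemma mulmxr_continuous m n p (A : 'M[K]_(m, n)) :
  continuous (fun v : 'M[K]_(p, m) => v *m A).
Proof.
have [C C0 HC] := mulmx_lipschitz A.
move=> v; apply: (proj2 (cvgrPdist_le (FF := nbhs_filter v) _ _)) => e e0.
have eC : 0 < e / C by rewrite divr_gt0.
apply: filterS (nbhsx_ballx v _ eC) => w; rewrite -ball_normE /= => vw.
rewrite -mulmxBl; apply: le_trans (HC _ _) _.
by rewrite mulrC -ler_pdivlMr // ltW.
Qed.

Variables m n : nat.
Implicit Types (f : 'rV[K]_m -> 'rV[K]_n) (x : 'rV[K]_m).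

Lemma jacobian_near_le f x (e : K) : differentiable f x -> 0 < e ->
  \forall y \near x, `|f y - f x - (y - x) *m 'J f x| <= e * `|y - x|.
Proof.
move=> df e0; apply: filterS (differentiable_near_le df e0) => y.
by rewrite /jacobian mul_rV_lin1.
Qed.

(** This is uniqueness of the differential, in the form used below to identify Jacobians from a
    first-order remainder estimate. *)
Lemma near_le_jacobian f x (A : 'M[K]_(m, n)) :
  (forall e : K, 0 < e ->
     \forall y \near x, `|f y - f x - (y - x) *m A| <= e * `|y - x|) ->
  differentiable f x /\ 'J f x = A.
Proof.
move=> fA; have [||dfx E] := @near_le_differentiable _ _ _ f x (mulmxr A).
- exact: mulmxr_continuous.
- exact: fA.
split=> //; apply/row_matrixP => i.
by rewrite !rowE /jacobian mul_rV_lin1 E.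
Qed.

End Matrices.

Lemma jacobian_comp (K : numFieldType) m n p (f : 'rV[K]_m -> 'rV[K]_n)
    (g : 'rV[K]_n -> 'rV[K]_p) x : differentiable f x -> differentiable g (f x) ->
  'J (g \o f) x = 'J f x *m 'J g (f x).
Proof.
move=> df dg; apply/row_matrixP => i; rewrite row_mul !rowE.
by rewrite /jacobian !mul_rV_lin1 diff_comp.
Qed.

Lemma jacobian_mulmxr (K : numFieldType) m n (A : 'M[K]_(m, n)) (x : 'rV[K]_m) :
  differentiable (fun v : 'rV[K]_m => v *m A) x /\ 'J (fun v : 'rV[K]_m => v *m A) x = A.
Proof.
apply: near_le_jacobian => e e0; apply: filterE => y /=.
by rewrite -mulmxBl subrr normr0 mulr_ge0 // ltW.
Qed.

Lemma near_is_derive (K : numFieldType) (g : K -> K) (t a : K) :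
  (forall e : K, 0 < e -> \forall s \near t, `|g s - g t - (s - t) * a| <= e * `|s - t|) ->
  is_derive t 1 g a.
Proof.
move=> gt.
have C : h^-1 *: (g (h *: 1 + t) - g t) @[h --> 0^'] --> a.
  apply/cvgrPdist_le => e e0; have := gt e e0.
  rewrite (near_shift 0) => /nbhs_ballP[r /= r0 H].
  apply/nbhs_ballP; exists r => //= h /H; rewrite /= subr0 addrK => Hh h0.
  rewrite [h *: 1]mulr1 distrC.
  have -> : h^-1 *: (g (h + t) - g t) - a = (g (h + t) - g t - h * a) / h.
    by rewrite /GRing.scale /=; field.
  by rewrite normrM normfV ler_pdivrMr // normr_gt0.
apply: DeriveDef; last exact: cvg_lim C.
by apply/cvg_ex; exists a.
Qed.

Lemma derivable_near_le (K : numFieldType) (g : K -> K) (t e : K) :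
  derivable g t 1 -> 0 < e ->
  \forall s \near t, `|g s - g t - (s - t) * 'D_1 g t| <= e * `|s - t|.
Proof.
move=> /derivable1_diffP dg e0; rewrite deriveE //.
apply: filterS (differentiable_near_le dg e0) => s.
have -> // : 'd g t (s - t) = (s - t) * 'd g t 1.
by rewrite -{1}[s - t]mulr1 -[_ * 1]/((s - t) *: (1 : K^o)) linearZ.
Qed.

(** * Semiregular zeros of strictly differentiable maps *)

Definition strictly_differentiable (K : numFieldType) m n
    (f : 'rV[K]_m -> 'rV[K]_n) (x : 'rV[K]_m) : Prop :=
  forall e : K, 0 < e -> exists2 d : K, 0 < d & forall y z, ball x d y -> ball x d z ->
    `|f y - f z - (y - z) *m 'J f x| <= e * `|y - z|.

(* Only differentiability at [z] is required, so this is not an instance of the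
   inverse function theorem. *)
Definition locally_onto (K : numFieldType) : Prop :=
  forall k (h : 'rV[K]_k -> 'rV[K]_k) (z : 'rV[K]_k) (U : set 'rV[K]_k),
    (\forall w \near z, {for w, continuous h}) ->
    differentiable h z -> 'J h z = 1%:M -> nbhs z U -> nbhs (h z) (h @` U).

Definition connected_balls (K : numFieldType) : Prop :=
  forall k (x : 'rV[K]_k) (e : K), connected (ball x e).

Section SemiregularZeros.
Context {K : numFieldType} {m n : nat}.
Implicit Types (Omega : set 'rV[K]_m) (f : 'rV[K]_m -> 'rV[K]_n) (x y v : 'rV[K]_m).

(** The hypothesis makes [row_mx P A] row free; [L1] and [L2] are the two blocks of its right
    inverse. *)
Lemma row_mx_left_inverse k (P : 'M[K]_(m, k)) (A : 'M[K]_(m, n)) :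
  (forall v, v *m P = 0 -> v *m A = 0 -> v = 0) ->
  exists L1 L2, forall v, v = v *m P *m L1 + v *m A *m L2.
Proof.
move=> PA; have G : row_free (row_mx P A).
  apply: inj_row_free => v; rewrite mul_mx_row -[0]row_mx0 => /eq_row_mx[].
  exact: PA.
exists (usubmx (pinvmx (row_mx P A))), (dsubmx (pinvmx (row_mx P A))) => v.
by rewrite -mul_row_col vsubmxK -mul_mx_row -mulmxA mulmxVp // mulmx1.
Qed.

(** Counting ranks, the rows of [B] span the whole kernel of [A], and multiplication by [pinvmx B]
    recovers the coefficients with respect to these rows. *)
Lemma kernel_complement k (B : 'M[K]_(k, m)) (A : 'M[K]_(m, n)) :
  B *m A = 0 -> \rank B = k -> (k + \rank A)%N = m ->
  B *m pinvmx B = 1%:M /\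
  (forall v, v *m pinvmx B = 0 -> v *m A = 0 -> v = 0).
Proof.
move=> BA rB rA; have Bf : row_free B by rewrite /row_free rB.
split=> [|v vP /sub_kermxP vA]; first exact: mulmxVp.
have /mxrank_leqif_sup[_] : (B <= kermx A)%MS by apply/sub_kermxP.
have -> : \rank (kermx A) = k by rewrite mxrank_ker; lia.
rewrite rB eqxx => /esym/(submx_trans vA)/submxP[D vD].
by move: vP; rewrite vD -mulmxA mulmxVp // mulmx1 => ->; rewrite mul0mx.
Qed.

(** Everything follows from [bnd]: whenever [v *m 'J f x] is small compared with [v], its term can
    be absorbed on the left. For [v = y - z] with [f y = f z] smallness is strict differentiability;
    for a kernel vector of ['J f y] it follows by comparing the expansions of [f] at [y] and at
    [x]. *)
Lemma zeros_Lipschitz f x k (P : 'M[K]_(m, k)) : strictly_differentiable f x ->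
  (forall v, v *m P = 0 -> v *m 'J f x = 0 -> v = 0) ->
  exists2 C : K, 0 < C & exists2 d : K, 0 < d &
    (forall y z, ball x d y -> ball x d z -> f y = f z ->
      `|y - z| <= C * `|y *m P - z *m P|) /\
    (forall y v, ball x d y -> differentiable f y ->
      v *m P = 0 -> v *m 'J f y = 0 -> v = 0).
Proof.
move=> fx /row_mx_left_inverse[L1 [L2 L]].
have [C1 C10 H1] := mulmx_lipschitz L1; have [C2 C20 H2] := mulmx_lipschitz L2.
have bnd v : `|v| <= C1 * `|v *m P| + C2 * `|v *m 'J f x|.
  by rewrite {1}(L v); apply: le_trans (ler_normD _ _) _; rewrite lerD.
(* The second claim uses the error [e] twice, so [C2 * e = 4^-1] still leaves the factor [2^-1]
   needed for absorption. *)
pose e := (4 * C2)^-1.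
have e0 : 0 < e by rewrite invr_gt0 mulr_gt0.
have C2e : C2 * e = 4^-1 by rewrite /e invfM mulrCA divff ?mulr1 // gt_eqF.
have [d d0 fd] := fx e e0.
exists (2 * C1); first by rewrite mulr_gt0.
exists d => //; split=> [y z yd zd fyz|y v yd dfy vP vJ].
  have := bnd (y - z); rewrite !mulmxBl => Hb.
  have := fd y z yd zd; rewrite fyz subrr sub0r normrN mulmxBl => He.
  have : C2 * `|y *m 'J f x - z *m 'J f x| <= 2^-1 * `|y - z|.
    apply: le_trans (ler_wpM2l (ltW C20) He) _; rewrite mulrA C2e.
    by rewrite ler_wpM2r // lef_pV2 ?posrE // ler_nat.
  move=> H3; have := le_trans Hb (lerD (lexx _) H3).
  rewrite -lerBlDr -{1}[`|y - z|]mul1r -mulrBl (_ : 1 - 2^-1 = 2^-1 :> K); last by field.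
  by rewrite ler_pdivrMl // mulrA.
have [-> //|v0] := eqVneq v 0; have nv0 : 0 < `|v| by rewrite normr_gt0.
have : \forall w \near y, ball x d w /\ `|f w - f y - (w - y) *m 'J f y| <= e * `|w - y|.
  apply: filterI; last exact: jacobian_near_le.
  by apply: open_nbhs_nbhs; split=> //; exact: ball_open.
move=> /nbhs_ballP[r /= r0 Hr].
(* The kernel vector is rescaled to norm [r / 2], so that [y + w] stays where both estimates hold;
   they then yield the impossible bound of the norm of [w] by half of itself. *)
pose w := (r / 2 / `|v|) *: v.
have nw : `|w| = r / 2.
  by rewrite normrZ ger0_norm ?divfK ?gt_eqF // ltW // !divr_gt0.
have [|xw] := Hr (y + w).
  by rewrite -ball_normE /= opprD addNKr normrN nw ltr_pdivrMr // ltr_pMr // ltr1n.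
rewrite [y + w]addrC addrK -scalemxAl vJ scaler0 subr0 => HJ.
have := fd _ _ xw yd; rewrite [y + w]addrC addrK => HA.
have : C2 * `|w *m 'J f x| <= 2^-1 * `|w|.
  have : `|w *m 'J f x| <= 2 * e * `|w|.
    rewrite -[X in `|X|](subKr (f (w + y) - f y)) -mulrA mulr_natl mulr2n.
    by apply: le_trans (ler_normB _ _) _; rewrite lerD.
  move=> /(ler_wpM2l (ltW C20))/le_trans; apply.
  by rewrite !mulrA [C2 * 2]mulrC -(mulrA 2) C2e ler_wpM2r // (_ : 2 * 4^-1 = 2^-1 :> K) //; field.
have := bnd w; rewrite -[w *m P]scalemxAl vP scaler0 normr0 mulr0 add0r.
move=> /le_trans H /H; rewrite -[X in X <= _]mul1r ler_pM2r ?nw ?divr_gt0 //.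
by rewrite invf_ge1 // lern1.
Qed.

(** The scalars enter only through local surjectivity and connectedness of balls, so the real and
    complex cases share this argument. *)
Lemma semiregular_zero_neighborhood Omega f xs : locally_onto K -> connected_balls K ->
  open Omega -> (forall x, Omega x -> differentiable f x) ->
  strictly_differentiable f xs -> semiregular_zero Omega f xs ->
  exists Delta : set 'rV[K]_m, [/\ open Delta, Delta xs &
    forall x, (Delta `&` zeros Omega f) x ->
      semiregular_zero Omega f x /\ same_branch Omega f xs x].
Proof.
move=> onto conn oO df sf [xs0 [k [dimk rk]]].
case: dimk => [[k0 iso]|[La [phi [z ch]]]].
  have [D [oD Dx DE]] := iso; exists D; split=> // x Dx'.
  have -> : x = xs by have : [set xs] x by rewrite -DE.
  split; last exact: same_branch_isolated.
  by split=> //; exists k; split=> //; left.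
have [k0 [De [oDe DeO Dexs DeE]] oLa _ dphi _ Lz phiz rphi] := ch.
pose A := 'J f xs; pose B := 'J phi z; pose P := pinvmx B.
have phi0 w : La w -> zeros Omega f (phi w).
  by move=> Lw; have [] : (De `&` zeros Omega f) (phi w) by rewrite DeE; exists w.
have Lnear : \forall w \near z, La w by exact: open_nbhs_nbhs.
have dphiz := dphi z Lz.
have dfz : differentiable f (phi z) by apply: df; rewrite phiz; case: xs0.
(* The composite of [f] with [phi] vanishes near [z], hence so does its Jacobian. *)
have BA : B *m A = 0.
  rewrite /A -phiz -jacobian_comp //; apply: (proj2 (near_le_jacobian _)) => e e0.
  apply: filterS Lnear => w Lw /=.
  by rewrite (proj2 (phi0 _ Lw)) (proj2 (phi0 _ Lz)) mulmx0 !subr0 normr0 mulr_ge0 // ltW.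
have [BP PA] := kernel_complement BA rphi rk.
have [C C0 [d d0 [Lip ker]]] := zeros_Lipschitz sf PA.
have [r /= r0 Ur] : exists2 r : K, 0 < r & ball xs r `<=` Omega `&` ball xs d.
  apply/nbhs_ballP; apply: filterI; last exact: nbhsx_ballx.
  by apply: open_nbhs_nbhs; split=> //; case: xs0.
pose U := ball xs r.
have UO x : U x -> Omega x by move=> /Ur[].
have Ud x : U x -> ball xs d x by move=> /Ur[].
pose h (w : 'rV[K]_k) := phi w *m P.
have hc : \forall w \near z, {for w, continuous h}.
  apply: filterS Lnear => w Lw.
  apply: (@continuous_comp _ _ _ phi (fun v : 'rV[K]_m => v *m P)).
    exact/differentiable_continuous/dphi.
  exact: mulmxr_continuous.
have [dP JP] := jacobian_mulmxr P (phi z).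
have dh : differentiable h z by exact: (differentiable_comp dphiz dP).
have Jh : 'J h z = 1%:M by rewrite (jacobian_comp dphiz dP) JP.
have zU : nbhs z (La `&` phi @^-1` U).
  apply: filterI; first exact: open_nbhs_nbhs.
  have phic := differentiable_continuous dphiz; apply: phic; rewrite phiz.
  exact: nbhsx_ballx.
(* Every coordinate value within [eta] of [h z] is taken at some zero lying in [U]; this gives
   existence of [psi], and the Lipschitz bound gives uniqueness. *)
have /nbhs_ballP[eta /= eta0 Hsurj] := onto k h z _ hc dh Jh zU.
pose c := h z; pose D0 := ball c eta.
have cE : c = xs *m P by rewrite /c /h phiz.
(* On [D0] the set is nonempty, so the default [xs] is never taken there. *)
pose psi (u : 'rV[K]_k) := xget xs [set x | [/\ U x, f x = 0 & x *m P = u]].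
have psiP u : D0 u -> [/\ U (psi u), f (psi u) = 0 & psi u *m P = u].
  move=> /Hsurj[w [Lw Uw] hw]; apply: (@xgetPex _ xs [set x | [/\ U x, f x = 0 & x *m P = u]]).
  by exists (phi w); split=> //; have [] := phi0 w Lw.
have uniq x y : U x -> U y -> f x = 0 -> f y = 0 -> `|x - y| <= C * `|x *m P - y *m P|.
  by move=> Ux Uy fx fy; apply: Lip; rewrite ?fx //; exact: Ud.
have psiK x : U x -> f x = 0 -> D0 (x *m P) -> psi (x *m P) = x.
  move=> Ux fx Dx; have [Up fp pP] := psiP _ Dx.
  apply/eqP; rewrite -subr_eq0 -normr_le0.
  by apply: le_trans (uniq _ _ Up Ux fp fx) _; rewrite pP subrr normr0 mulr0.
have oD0 : open D0 by exact: ball_open.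
have D0near u : D0 u -> \forall u' \near u, D0 u' by move=> Du; exact: open_nbhs_nbhs.
(* Cutting [U] down to points with coordinates in [D0] makes its zeros exactly the image of
   [psi]. *)
pose Dl := U `&` (fun x => x *m P) @^-1` D0.
have oDl : open Dl.
  apply: openI; first exact: ball_open.
  by apply: open_comp oD0 => x _; exact: mulmxr_continuous.
have DlE : Dl `&` zeros Omega f = psi @` D0.
  apply/seteqP; split=> [x [[Ux Dx] [_ fx]]|_ [u Du <-]].
    by exists (x *m P) => //; exact: psiK.
  by have [Up fp pP] := psiP u Du; split; split=> //=; [rewrite pP|exact: UO].
have psid u : D0 u -> [/\ differentiable psi u, \rank ('J psi u) = k &
    (k + \rank ('J f (psi u)))%N = m].
  move=> Du; have [Up fp pP] := psiP u Du; set x := psi u in Up fp pP *.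
  have dfx : differentiable f x by exact/df/UO.
  have kerx v : v *m P = 0 -> v *m 'J f x = 0 -> v = 0 by apply: ker => //; exact: Ud.
  have [L1 [L2 L]] := row_mx_left_inverse kerx.
  have [C2 C20 H2] := mulmx_lipschitz L2.
  have Lpsi u' : D0 u' -> `|psi u' - x| <= C * `|u' - u|.
    by move=> Du'; have [Up' fp' pP'] := psiP u' Du'; rewrite -{2}pP' -pP; exact: uniq.
  have psic : psi u' @[u' --> u] --> x.
    apply: (proj2 (cvgrPdist_le (FF := nbhs_filter u) _ _)) => e e0.
    have eC : 0 < e / C by rewrite divr_gt0.
    apply: filterS (filterI (D0near u Du) (nbhsx_ballx u _ eC)) => u' [Du'].
    rewrite -ball_normE /= => uu'; rewrite distrC; apply: le_trans (Lpsi u' Du') _.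
    by rewrite mulrC -ler_pdivlMr // distrC ltW.
  (* Splitting [psi u' - x] by [L], the [P] part is exactly [(u' - u) *m L1]. The other part is of
     smaller order, because [f] vanishes at both points and [psi] is Lipschitz; [C2] and [C] in the
     tolerance account for [L2] and for [psi]. *)
  have [dpsi Jpsi] : differentiable psi u /\ 'J psi u = L1.
    apply: near_le_jacobian => e e0.
    have e'0 : 0 < e / (C2 * C) by rewrite divr_gt0 // mulr_gt0.
    have := psic _ (jacobian_near_le dfx e'0).
    apply: filterS2 (D0near u Du) => u' Du' /=; rewrite -/x.
    have [Up' fp' pP'] := psiP u' Du'.
    rewrite fp' fp subrr sub0r normrN => HJ.
    rewrite {1}(L (psi u' - x)) [_ *m P]mulmxBl pP pP' addrC addKr.
    apply: le_trans (H2 _ _) _; rewrite -ler_pdivlMl //; apply: le_trans HJ _.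
    rewrite -ler_pdivlMl //; apply: le_trans (Lpsi u' Du') _.
    rewrite !invfM !invrK !mulrA [e^-1 * _ * _]mulrAC.
    rewrite [X in _ <= X * _](_ : _ = C) //; field.
    by rewrite !gt_eqF.
  (* [psi] is a section of [v *m P], so the chain rule gives the identity. *)
  have L1P : L1 *m P = 1%:M.
    rewrite -Jpsi; have [dP' JP'] := jacobian_mulmxr P x.
    rewrite -{1}JP' -(jacobian_comp dpsi dP').
    apply: (proj2 (near_le_jacobian _)) => e e0.
    apply: filterS (D0near u Du) => u' Du' /=.
    have [Up' fp' pP'] := psiP u' Du'.
    by rewrite -/x pP pP' mulmx1 subrr normr0 mulr_ge0 // ltW.
  have L1J : L1 *m 'J f x = 0.
    rewrite -Jpsi -jacobian_comp //.
    apply: (proj2 (near_le_jacobian _)) => e e0.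
    apply: filterS (D0near u Du) => u' Du' /=.
    have [Up' fp' pP'] := psiP u' Du'.
    by rewrite -/x fp fp' mulmx0 !subr0 normr0 mulr_ge0 // ltW.
  have rL1 : \rank L1 = k by apply/eqP/row_freeP; exists P.
  rewrite Jpsi; split; [exact: dpsi|exact: rL1|].
  (* [L1 *m 'J f x = 0] bounds the sum of ranks by [m] from above; row freeness of
     [row_mx P ('J f x)] bounds it from below. *)
  apply/eqP; rewrite eqn_leq; apply/andP; split.
    by rewrite -{1}rL1; exact: mulmx0_rank_max L1J.
  have G : row_free (row_mx P ('J f x)).
    apply: inj_row_free => v; rewrite mul_mx_row -[0]row_mx0 => /eq_row_mx[].
    exact: kerx.
  rewrite -{1}(eqP G) -mxrank_tr tr_row_mx -addsmxE.
  apply: leq_trans (mxrank_adds_leqif _ _) _; rewrite !mxrank_tr leq_add2r.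
  exact: rank_leq_col.
have chart x : (Dl `&` zeros Omega f) x -> zero_chart Omega f x D0 psi (x *m P).
  move=> Dx; have [[Ux Dx0] [_ fx]] := Dx; apply: ZeroChart.
  - exact: k0.
  - by exists Dl; split; [exact: oDl|move=> y [/UO]|case: Dx|exact: DlE].
  - exact: oD0.
  - exact: conn.
  - by move=> u /psid[].
  - move=> u u' /set_mem Du /set_mem Du' E.
    by have [_ _ <-] := psiP u Du; have [_ _ <-] := psiP u' Du'; rewrite E.
  - exact: Dx0.
  - exact: psiK.
  - by have [_ -> _] := psid _ Dx0.
have Dlxs : Dl xs.
  split; [exact: ballxx|rewrite /= -cE; exact: ballxx].
exists Dl; split; [exact: oDl|exact: Dlxs|move=> x Dx]; have [[Ux Dx0] [_ fx]] := Dx.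
split.
  split; first by case: Dx.
  exists k; split; first by right; exists D0, psi, (x *m P); exact: chart.
  by have [_ _] := psid _ Dx0; rewrite psiK.
(* A single chart step suffices: [psi] is a chart based at [xs] with rank [k] on all of [D0]. *)
apply: (@same_branch_chart _ _ _ Omega f xs x k D0 D0 psi (xs *m P)).
- by apply: chart; split; [exact: Dlxs|exact: xs0].
- exact: oD0.
- by [].
- by rewrite -cE; exact: ballxx.
- by move=> u /psid[_ ->].
- by exists (x *m P) => //; exact: psiK.
Qed.

End SemiregularZeros.

(** * Real and complex scalars *)

(* [real_scalars R K] presents K as a finite-dimensional R-algebra with an
   R-valued norm, so that K = R and K = R[i] are handled together. *)
Record real_scalars (R : realType) (K : numFieldType) := RealScalarsBasis {
  basis_size : nat;
  real_emb : {rmorphism R -> K};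
  real_re : K -> R;
  real_basis : 'I_basis_size -> K;
  reB : forall x y, real_re (x - y) = real_re x - real_re y;
  re1 : real_re 1 = 1;
  re_embM : forall a x, real_re (real_emb a * x) = a * real_re x;
  emb_re_norm : forall x : K, real_emb (real_re `|x|) = `|x|;
  norm_re_le : forall x : K, `|real_re x| <= real_re `|x|;
  emb_le : forall a b, (real_emb a <= real_emb b) = (a <= b);
  basis_norm : forall i, `|real_basis i| = 1;
  basisE : forall x, x = \sum_i real_emb (real_re (x / real_basis i)) * real_basis i;
  basis_dual : forall i j, real_re (real_basis j / real_basis i) = (i == j)%:R
}.
Arguments RealScalarsBasis {R K basis_size real_emb real_re real_basis}.

Section RealScalars.
Context {R : realType} {K : numFieldType} (S : real_scalars R K).
Notation d := (basis_size S).
Notation emb := (real_emb S).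
Notation re := (real_re S).
Notation b := (@real_basis _ _ S).

Lemma re0 : re 0 = 0. Proof. by rewrite -(subrr 1) reB subrr. Qed.

Lemma reD x y : re (x + y) = re x + re y.
Proof. have -> : x + y = x - (0 - y) by rewrite sub0r opprK. by rewrite !reB re0; lra. Qed.

Lemma emb_lt a c : (emb a < emb c) = (a < c).
Proof. by rewrite !lt_neqAle fmorph_eq emb_le. Qed.

Lemma emb_gt0 a : (0 < emb a) = (0 < a).
Proof. by rewrite -[X in X < _](rmorph0 emb) emb_lt. Qed.

Lemma emb_ge0 a : (0 <= emb a) = (0 <= a).
Proof. by rewrite -[X in X <= _](rmorph0 emb) emb_le. Qed.

Lemma norm_emb a : `|emb a| = emb `|a|.
Proof.
have [a0|a0] := leP 0 a; first by rewrite !ger0_norm ?emb_ge0.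
by rewrite [in RHS]ltr0_norm // rmorphN ltr0_norm // -oppr_gt0 -rmorphN emb_gt0 oppr_gt0.
Qed.

Lemma emb_re_gt0 (e : K) : 0 < e -> 0 < re e /\ emb (re e) = e.
Proof.
move=> e0; have E : emb (re e) = e by rewrite -(gtr0_norm e0) emb_re_norm.
by split=> //; rewrite -emb_gt0 E.
Qed.

Lemma emb_re_ge0 (e : K) : 0 <= e -> emb (re e) = e.
Proof. by move=> e0; rewrite -(ger0_norm e0) emb_re_norm. Qed.

Lemma re_le_emb x a : `|x| <= emb a -> `|re x| <= a.
Proof. by rewrite -(emb_re_norm S) emb_le; apply: le_trans; exact: norm_re_le. Qed.

Lemma embZ_lipschitz (V : normedModType K) (v : V) (s t : R) :
  `|emb s *: v - emb t *: v| = emb `|s - t| * `|v|.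
Proof. by rewrite -scalerBl -rmorphB normrZ norm_emb. Qed.

Lemma segment_continuous (V : normedModType K) (x v : V) :
  continuous (fun t => x + emb t *: v).
Proof.
move=> t; apply/cvgrPdist_le => e e0.
have [re0' reE] := emb_re_gt0 e0.
have nv : 0 < `|v| + 1 by rewrite ltr_wpDl.
have [rv0 rvE] := emb_re_gt0 nv.
have r0 : 0 < re e / re (`|v| + 1) by rewrite divr_gt0.
apply: filterS (nbhsx_ballx t _ r0) => s; rewrite -ball_normE /= => ts.
rewrite /= [x + _]addrC addrKA embZ_lipschitz -[leRHS]reE.
apply: le_trans (_ : emb `|t - s| * (`|v| + 1) <= _).
  by rewrite ler_wpM2l ?emb_ge0 // lerDl.
by rewrite -[X in _ * X]rvE -rmorphM emb_le -ler_pdivlMr // ltW.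
Qed.

Lemma ball_convex k (x y z : 'rV[K]_k) (e : K) (t : R) : ball x e y -> ball x e z ->
  0 <= t <= 1 -> ball x e (z + emb t *: (y - z)).
Proof.
rewrite -ball_normE /= => xy xz /andP[t0 t1].
have -> : x - (z + emb t *: (y - z)) = emb (1 - t) *: (x - z) + emb t *: (x - y).
  by apply/rowP => i; rewrite !mxE rmorphB rmorph1; ring.
apply: le_lt_trans (ler_normD _ _) _; rewrite !normrZ !norm_emb !ger0_norm ?subr_ge0 //.
(* For [t > 0] the strict inequality comes from the [y] term; at [t = 0] the point is [z]. *)
have [->|t0'] := eqVneq t 0; first by rewrite rmorph0 mul0r addr0 subr0 rmorph1 mul1r.
have tt : 0 < emb t by rewrite emb_gt0 lt_neqAle eq_sym t0'.
have -> : e = emb (1 - t) * e + emb t * e by rewrite -mulrDl -rmorphD subrK rmorph1 mul1r.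
apply: ler_ltD; last by rewrite ltr_pM2l.
by rewrite ler_wpM2l ?emb_ge0 ?subr_ge0 // ltW.
Qed.

(** A ball is a union of real segments issuing from its centre; a radius that is not positive gives
    the empty set. *)
Lemma real_scalars_connected_balls : connected_balls K.
Proof.
move=> k x e; have [e0|e0] := pselect (0 < e); last first.
  suff -> : ball x e = set0 by exact: connected0.
  by apply/seteqP; split=> // y [] /e0.
pose seg y := (fun t => x + emb t *: (y - x)) @` `[0, 1]%classic.
suff -> : ball x e = \bigcup_(y in ball x e) seg y.
  apply: bigcup_connected => [|y yx].
    by exists x => y yx; exists 0; rewrite ?rmorph0 ?scale0r ?addr0 //= in_itv /= lexx ler01.
  apply: connected_continuous_connected; first exact: segment_connected.
  exact/continuous_subspaceT/segment_continuous.
apply/seteqP; split=> [y xy|y [w xw [t t01 <-]]].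
  exists y => //; exists 1; rewrite ?rmorph1 ?scale1r //= ?in_itv /= ?lexx ?ler01 //.
  by rewrite addrC subrK.
by apply: ball_convex xw (ballxx x e0) _; move: t01; rewrite /= in_itv.
Qed.

(** The real mean value theorem is applied on the segment from [z] to [y] to the real part of one
    entry of [f] minus its linear part. *)
Lemma real_scalars_strict m n (f : 'rV[K]_m -> 'rV[K]_n) (x : 'rV[K]_m) :
  (forall e : K, 0 < e -> \forall y \near x, differentiable f y /\
     forall v : 'rV[K]_m, `|v *m 'J f y - v *m 'J f x| <= e * `|v|) ->
  strictly_differentiable f x.
Proof.
rewrite /strictly_differentiable; move: ('J f x) => A Hf e e0.
have /nbhs_ballP[r /= r0 Hr] := Hf e e0; exists r => // y z yr zr.
set v := y - z.
apply/mx_norm_leP => [|i j]; first by rewrite mulr_ge0 // ltW.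
set D := (f y - f z - v *m A) i j.
(* The unimodular factor [c] turns the entry [D] into its absolute value, so that nothing is lost by
   taking real parts. *)
have [->|D0] := eqVneq D 0; first by rewrite normr0 mulr_ge0 // ltW.
pose c := `|D| / D.
have nc : `|c| = 1 by rewrite normrM normfV normr_id divff // normr_eq0.
pose w t := z + emb t *: v.
have wr (t : R) : 0 <= t <= 1 -> ball x r (w t) by exact: ball_convex.
pose g t := re (c * (f (w t) - emb t *: (v *m A)) i j).
pose dg t := re (c * (v *m 'J f (w t) - v *m A) i j).
have nv : `|v| = emb (re `|v|) by rewrite emb_re_ge0.
have rv0 : 0 <= re `|v| by rewrite -emb_ge0 -nv.
have gder (t : R) : 0 <= t <= 1 -> is_derive t 1 g (dg t).
  move=> t01; have [dfw _] := Hr _ (wr t t01).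
  apply: near_is_derive => h h0.
  pose h' := h / (re `|v| + 1).
  have h'0 : 0 < emb h' by rewrite emb_gt0 divr_gt0 // ltr_wpDl.
  have near_t : \forall s \near t, `|f (w s) - f (w t) - (w s - w t) *m 'J f (w t)|
      <= emb h' * `|w s - w t|.
    exact: (@segment_continuous _ z v t _ (jacobian_near_le dfw h'0)).
  apply: filterS near_t => s Hs.
  have wst : w s - w t = emb (s - t) *: v.
    by rewrite /w opprD addrACA subrr add0r -scalerBl rmorphB.
  have -> : g s - g t - (s - t) * dg t =
      re (c * (f (w s) - f (w t) - (w s - w t) *m 'J f (w t)) i j).
    rewrite /g /dg -re_embM -!reB wst -scalemxAl rmorphB; congr re.
    move: ('J f (w t)) (f (w s)) (f (w t)) => J fs ft.
    move: (v *m J) (v *m A) => X Y.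
    by rewrite !mxE; ring.
  apply: re_le_emb; rewrite normrM nc mul1r; apply: le_trans (mx_coord_le _ i j) _.
  apply: le_trans Hs _; rewrite wst normrZ norm_emb nv -!rmorphM emb_le /h'.
  rewrite mulrACA ler_piMr ?mulr_ge0 ?(ltW h0) //.
  by rewrite [_^-1 * _]mulrC ler_pdivrMr ?mul1r ?lerDl // ltr_wpDl.
have [|||t t01] := @MVT R g dg 0 1.
- exact: ltr01.
- by move=> t /= t01; apply: gder; move: t01; rewrite in_itv /= => /andP[/ltW -> /ltW ->].
- by apply: derivable_within_continuous => t; rewrite in_itv /= => /gder[].
rewrite subr0 mulr1 => E.
have : re `|D| = dg t.
  rewrite -E /g -reB; congr re.
  rewrite -mulrBr /w rmorph1 rmorph0 !scale1r !scale0r addr0 [z + v]addrC subrK.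
  rewrite -[`|D|](divfK D0) -/c; congr (_ * _).
  rewrite /D; move: (v *m A) (f y) (f z) => X fy fz.
  by rewrite !mxE; ring.
have t01' : 0 <= t <= 1 by move: t01; rewrite in_itv /= => /andP[/ltW -> /ltW ->].
have [_ Hw] := Hr (w t) (wr t t01').
move=> DE; rewrite -(emb_re_norm S) DE; apply: le_trans (Hw v).
rewrite -[leRHS](emb_re_ge0 (normr_ge0 _)) emb_le; apply: le_trans (ler_norm _) _; apply: re_le_emb.
by rewrite emb_re_ge0 // normrM nc mul1r; exact: mx_coord_le.
Qed.

(** * Real coordinates on vectors over [K], and local surjectivity *)

Definition of_coords k (x : 'rV[R]_(k * d)) : 'rV[K]_k :=
  \row_j \sum_(i < d) emb (vec_mx x j i) * b i.

Definition coords k (v : 'rV[K]_k) : 'rV[R]_(k * d) :=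
  mxvec (\matrix_(j, i) re (v 0 j / b i)).

Lemma coordsK k : cancel (@coords k) (@of_coords k).
Proof.
move=> v; apply/rowP => j; rewrite mxE [RHS](basisE S).
by apply: eq_bigr => i _; rewrite mxvecK mxE.
Qed.

Lemma re_sum I (r : seq I) (F : I -> K) : re (\sum_(i <- r) F i) = \sum_(i <- r) re (F i).
Proof. by elim/big_rec2: _ => [|i y x _ <-]; rewrite ?re0 ?reD. Qed.

Lemma of_coordsK k : cancel (@of_coords k) (@coords k).
Proof.
move=> x; rewrite -[RHS]vec_mxK; congr mxvec; apply/matrixP => j i.
rewrite mxE [X in re (X / _)]mxE mulr_suml re_sum (bigD1 i) //= -mulrA re_embM basis_dual eqxx mulr1.
rewrite big1 ?addr0 // => l li.
by rewrite -mulrA re_embM basis_dual eq_sym (negbTE li) mulr0.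
Qed.

Lemma coordsB k (u v : 'rV[K]_k) : coords (u - v) = coords u - coords v.
Proof.
rewrite /coords -linearB; congr mxvec; apply/matrixP => j i.
by rewrite !mxE mulrBl reB.
Qed.

Lemma norm_coords_le k (v : 'rV[K]_k) a : `|v| <= emb a -> `|coords v| <= a.
Proof.
move=> va; have a0 : 0 <= a by rewrite -emb_ge0; apply: le_trans va.
apply/mx_norm_leP => // i l; rewrite ord1; case/mxvec_indexP: l => j l.
rewrite mxvecE mxE; apply: re_le_emb; rewrite normrM normfV basis_norm invr1 mulr1.
exact: le_trans (mx_coord_le v 0 j) va.
Qed.

Lemma norm_of_coords_le k (x : 'rV[R]_(k * d)) : `|of_coords x| <= emb (d%:R * `|x|).
Proof.
apply/mx_norm_leP => [|i j]; first by rewrite emb_ge0 mulr_ge0.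
rewrite mxE; apply: le_trans (ler_norm_sum _ _ _) _.
rewrite mulr_natl rmorphMn /= -[X in _ *+ X]card_ord -sumr_const.
apply: ler_sum => l _; rewrite normrM basis_norm mulr1 norm_emb emb_le.
by rewrite mxE; exact: mx_coord_le.
Qed.

Lemma of_coordsB k (x y : 'rV[R]_(k * d)) : of_coords (x - y) = of_coords x - of_coords y.
Proof. by rewrite -[LHS]coordsK -[RHS]coordsK coordsB !of_coordsK. Qed.

Lemma coords_continuous k : continuous (@coords k).
Proof.
move=> v; apply: (proj2 (cvgrPdist_le (FF := nbhs_filter v) _ _)) => e e0.
have e'0 : 0 < emb e by rewrite emb_gt0.
apply: filterS (nbhsx_ballx v _ e'0) => w; rewrite -ball_normE /= => vw.
by rewrite -coordsB; apply/norm_coords_le/ltW.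
Qed.

Lemma of_coords_continuous k : continuous (@of_coords k).
Proof.
move=> x; apply: (proj2 (cvgrPdist_le (FF := nbhs_filter x) _ _)) => e e0.
have [re0' reE] := emb_re_gt0 e0.
have r0 : 0 < re e / d.+1%:R by rewrite divr_gt0.
apply: filterS (nbhsx_ballx x _ r0) => y; rewrite -ball_normE /= => xy.
rewrite -of_coordsB; apply: le_trans (norm_of_coords_le _) _.
rewrite -reE emb_le; apply: le_trans (_ : d.+1%:R * `|x - y| <= _).
  by rewrite ler_wpM2r // ler_nat.
by rewrite mulrC -ler_pdivlMr // ltW.
Qed.

(** Since the Jacobian at [z] is the identity, [h] recentred at [z] and read in real coordinates is
    within [r / 2] of the identity on a small cube, and [near_identity_onto] applies. *)
Lemma real_scalars_locally_onto : locally_onto K.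
Proof.
move=> k h z U hc dh Jh zU.
(* Passing from real coordinates to [K] multiplies norms by at most [d], bounded here by the
   positive [d.+1]; this [eps] turns the remainder into [r / 2]. *)
pose eps : R := (2 * d.+1%:R)^-1.
have eps0 : 0 < eps by rewrite invr_gt0 mulr_gt0.
have e0 : 0 < emb eps by rewrite emb_gt0.
have zI A B := @filterI _ (nbhs z) (nbhs_filter z) A B.
have zH := zI _ _ zU (zI _ _ hc (jacobian_near_le dh e0)).
have [del /= del0] := proj1 (nbhs_ballP _ _) zH; rewrite Jh => Hdel.
have [rdel0 rdelE] := emb_re_gt0 del0.
pose r := re del / 2 / d.+1%:R.
have r0 : 0 < r by rewrite !divr_gt0.
have zr (x : 'rV[R]_(k * d)) : `|x| <= r -> `|of_coords x| <= emb (d.+1%:R * r).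
  move=> xr; apply: le_trans (norm_of_coords_le _) _; rewrite emb_le ler_pM //.
  by rewrite ler_nat.
have zdel (x : 'rV[R]_(k * d)) : `|x| <= r -> ball z del (z + of_coords x).
  move=> xr; rewrite -ball_normE /= opprD addNKr normrN -rdelE.
  apply: le_lt_trans (zr x xr) _; rewrite emb_lt /r mulrC divfK ?gt_eqF //.
  by rewrite ltr_pdivrMr // ltr_pMr // ltr1n.
pose g x := coords (h (z + of_coords x) - h z).
have gc (x : 'rV[R]_(k * d)) : `|x| <= r -> {for x, continuous g}.
  move=> xr; have [_ [hx _]] := Hdel _ (zdel x xr).
  apply: (@continuous_comp _ _ _ (fun x => h (z + of_coords x) - h z) (@coords k)).
    apply: continuousB; last exact: cst_continuous.
    apply: (@continuous_comp _ _ _ (fun x => z + of_coords x) h) => //.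
    apply: continuousD; first exact: cst_continuous.
    exact: of_coords_continuous.
  exact: coords_continuous.
have gid (x : 'rV[R]_(k * d)) : `|x| <= r -> `|g x - x| <= r / 2.
  move=> xr; have [_ [_]] := Hdel _ (zdel x xr).
  rewrite mulmx1 [z + _]addrC addrK addrC => Hx.
  rewrite -{2}(of_coordsK x) /g -coordsB; apply: norm_coords_le.
  apply: le_trans Hx _.
  apply: le_trans (ler_wpM2l (ltW e0) (zr x xr)) _.
  rewrite -rmorphM emb_le /eps invfM mulrA -[_ * d.+1%:R]mulrA mulVf ?gt_eqF //.
  by rewrite mulr1 mulrC.
apply/nbhs_ballP; exists (emb (r / 2)); first by rewrite /= emb_gt0 divr_gt0.
move=> u; rewrite -ball_normE /= distrC => hu.
have [x xr gx] := near_identity_onto r0 gc gid (norm_coords_le (ltW hu)).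
exists (z + of_coords x); first by have [] := Hdel _ (zdel x xr).
have := congr1 (@of_coords k) gx; rewrite /g !coordsK.
exact: addIr.
Qed.

End RealScalars.

Definition real_real_scalars (R : realType) : real_scalars R R.
Proof.
refine (@RealScalarsBasis R R 1 idfun id (fun=> 1) _ _ _ _ _ _ _ _ _) => //=.
- by move=> _; exact: normr1.
- by move=> x; rewrite big_ord1 divr1 mulr1.
- by move=> i j; rewrite !ord1 divr1 eqxx.
Defined.

Lemma complex_real_scalars_spec (R : realType) :
  let b (i : 'I_2) : R[i] := if i == 0 then 1 else 'i%C in
  [/\ forall i, `|b i| = 1,
      forall x, x = \sum_i real_complex R (complex.Re (x / b i)) * b i &
      forall i j, complex.Re (b j / b i) = (i == j)%:R].
Proof.
have iV : ('i%C : R[i])^-1 = - 'i%C.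
  apply/eqP; rewrite eq_complex /= expr0n expr1n add0r mul0r oppr0 divr1.
  by rewrite !eqxx.
split.
- move=> i; case: ifP => _; rewrite ?normr1 // normc_def /= expr0n expr1n add0r sqrtr1.
  by [].
- move=> x; rewrite big_ord_recl big_ord1 /= divr1 mulr1 {1}[x]complexE mulrC.
  rewrite iV mulrN; congr (_ + _%:C%C * _); case: x => x y /=.
  by rewrite mulr0 mulr1 sub0r opprK.
- move=> i j; case: (altP (i =P 0)) => [->|i0]; case: (altP (j =P 0)) => [->|j0].
  + by rewrite divr1.
  + by rewrite divr1 /= eq_sym (negbTE j0).
  + by rewrite mul1r iV /= oppr0 (negbTE i0).
  + rewrite divff /=; last by rewrite eq_complex /= oner_eq0 andbF.
    have -> : i = j by apply/val_inj; case: i j i0 j0 => [[|[|//]] ?] [[|[|//]] ?].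
    by rewrite eqxx.
Qed.

Definition complex_real_scalars (R : realType) : real_scalars R R[i].
Proof.
refine (@RealScalarsBasis R R[i] 2 (real_complex R) (@complex.Re R)
  (fun i => if i == 0 then 1 else 'i%C) _ _ _ _ _ _ _ _ _).
- by move=> [a1 a2] [a3 a4].
- by [].
- by move=> a [x y] /=; rewrite mul0r subr0.
- by move=> x; exact: (RRe_real (normr_real x)).
- by move=> x; rewrite -lecR (RRe_real (normr_real x)); exact: normc_ge_Re.
- exact: lecR.
- by have [] := complex_real_scalars_spec R.
- by have [] := complex_real_scalars_spec R.
- by have [] := complex_real_scalars_spec R.
Defined.

(** * Goursat's lemma *)

Section Goursat.
Context {R : realType}.
Implicit Types (f : R -> R) (P Q : R -> R -> R) (a b c d x y : R).

Definition segment_integral f a b : R :=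
  (\int[lebesgue_measure]_(x in `[a, b]) f x)%R.

Definition continuous_on_segment f a b :=
  forall x, a <= x <= b -> {for x, continuous f}.

Lemma segment_integrable f a b : continuous_on_segment f a b ->
  lebesgue_measure.-integrable `[a, b] (EFin \o f).
Proof.
move=> fc; apply: continuous_compact_integrable; first exact: segment_compact.
by apply: continuous_in_subspaceT => x /set_mem; rewrite /= in_itv; exact: fc.
Qed.

Lemma segment_integralB f g a b :
  continuous_on_segment f a b -> continuous_on_segment g a b ->
  segment_integral (fun x => f x - g x) a b = segment_integral f a b - segment_integral g a b.
Proof. by move=> fc gc; apply: RintegralB => //; exact: segment_integrable. Qed.

Lemma segment_integral_split f a b m : continuous_on_segment f a b -> a <= m <= b ->
  segment_integral f a b = segment_integral f a m + segment_integral f m b.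
Proof.
move=> fc /andP[am mb]; apply/eqP; rewrite addrC -subr_eq; apply/eqP.
have fi := segment_integrable fc.
rewrite /segment_integral Rintegral_itvB ?bnd_simp // Rintegral_itv_obnd_cbnd //.
apply: integrableS fi => //.
by apply: subset_itv; rewrite bnd_simp.
Qed.

Lemma segment_integral_cst k a b : a <= b -> segment_integral (fun=> k) a b = k * (b - a).
Proof.
move=> ab; rewrite /segment_integral Rintegral_cst //= lebesgue_measure_itv /= lte_fin.
have [->|ab'] := eqVneq a b; first by rewrite ltxx subrr mulr0.
by rewrite lt_neqAle ab' ab.
Qed.

(** The integral is compared with those of the constants [k - e] and [k + e]. *)
Lemma segment_integral_approx f a b k e : a <= b -> continuous_on_segment f a b ->
  (forall x, a <= x <= b -> `|f x - k| <= e) ->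
  `|segment_integral f a b - k * (b - a)| <= e * (b - a).
Proof.
move=> ab fc fk.
have ci (l : R) : lebesgue_measure.-integrable `[a, b] (EFin \o (fun=> l)).
  by apply: segment_integrable => x _; exact: cst_continuous.
have lo : segment_integral (fun=> k - e) a b <= segment_integral f a b.
  apply: le_Rintegral => //; first exact: segment_integrable.
  by move=> x /=; rewrite in_itv => /fk; rewrite ler_norml; lra.
have hi : segment_integral f a b <= segment_integral (fun=> k + e) a b.
  apply: le_Rintegral => //; first exact: segment_integrable.
  by move=> x /=; rewrite in_itv => /fk; rewrite ler_norml; lra.
move: lo hi; rewrite !segment_integral_cst // mulrBl mulrDl ler_norml.
by move=> lo hi; apply/andP; split; lra.
Qed.

Lemma near_lipschitz_continuous f x (C r : R) : 0 < r ->
  (forall y, `|y - x| <= r -> `|f y - f x| <= C * `|y - x|) -> {for x, continuous f}.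
Proof.
move=> r0 fC; apply/cvgrPdist_le => e e0.
have C0 : 0 < `|C| + 1 by rewrite ltr_wpDl.
pose s := Num.min r (e / (`|C| + 1)).
have s0 : 0 < s by rewrite lt_min r0 divr_gt0.
apply: filterS (nbhsx_ballx x _ s0) => y; rewrite -ball_normE /= => xy.
have := xy; rewrite distrC lt_min => /andP[yr ye].
rewrite distrC; apply: le_trans (fC _ (ltW yr)) _.
apply: le_trans (_ : (`|C| + 1) * `|y - x| <= _).
  by rewrite ler_wpM2r // (le_trans (ler_norm C)) // lerDl.
by rewrite mulrC -ler_pdivlMr // ltW.
Qed.

(* The field (P, Q) is differentiable at (x0, y0) with divergence A - A = 0. *)
Definition divergence_free_at P Q x0 y0 := exists A B D, forall e, 0 < e ->
  exists2 r, 0 < r & forall x y, `|x - x0| <= r -> `|y - y0| <= r ->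
    `|P x y - P x0 y0 - (A * (x - x0) + B * (y - y0))| <= e * (`|x - x0| + `|y - y0|) /\
    `|Q x y - Q x0 y0 - (D * (x - x0) - A * (y - y0))| <= e * (`|x - x0| + `|y - y0|).

Lemma divergence_free_continuous P Q x0 y0 : divergence_free_at P Q x0 y0 ->
  {for y0, continuous (P x0)} /\ {for x0, continuous (Q^~ y0)}.
Proof.
move=> [A [B [D H]]]; have [r r0 Hr] := H 1 ltr01; split.
  apply: (@near_lipschitz_continuous _ _ (1 + `|B|) r) => // y yr.
  have [|+ _] := Hr x0 y _ yr; first by rewrite subrr normr0 ltW.
  rewrite subrr mulr0 normr0 !add0r mul1r mulrDl mul1r => H1.
  rewrite -[X in `|X| <= _](subrK (B * (y - y0))); apply: le_trans (ler_normD _ _) _.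
  by rewrite normrM lerD.
apply: (@near_lipschitz_continuous _ _ (1 + `|D|) r) => // x xr.
have [|_] := Hr x y0 xr; first by rewrite subrr normr0 ltW.
rewrite subrr mulr0 normr0 subr0 addr0 mul1r mulrDl mul1r => H1.
rewrite -[X in `|X| <= _](subrK (D * (x - x0))); apply: le_trans (ler_normD _ _) _.
by rewrite normrM lerD.
Qed.

(** Outward flux through the boundary of the rectangle, with opposite sides gathered under one
    integral. *)
Definition flux P Q a b c d : R :=
  segment_integral (fun y => P b y - P a y) c d + segment_integral (fun x => Q x d - Q x c) a b.

Definition divergence_free P Q a b c d :=
  forall x y, a <= x <= b -> c <= y <= d -> divergence_free_at P Q x y.

Lemma divergence_free_sub P Q a b c d a' b' c' d' : divergence_free P Q a b c d ->
  a <= a' -> b' <= b -> c <= c' -> d' <= d -> divergence_free P Q a' b' c' d'.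
Proof.
move=> H aa bb cc dd x y /andP[ax xb] /andP[cy yd]; apply: H; apply/andP; split; lra.
Qed.

Lemma divergence_free_continuousP P Q a b c d x : divergence_free P Q a b c d ->
  a <= x <= b -> continuous_on_segment (P x) c d.
Proof. by move=> H ab y cd; have [] := divergence_free_continuous (H x y ab cd). Qed.

Lemma divergence_free_continuousQ P Q a b c d y : divergence_free P Q a b c d ->
  c <= y <= d -> continuous_on_segment (Q^~ y) a b.
Proof. by move=> H cd x ab; have [] := divergence_free_continuous (H x y ab cd). Qed.

Lemma fluxE P Q a b c d : a <= b -> c <= d -> divergence_free P Q a b c d ->
  flux P Q a b c d = segment_integral (P b) c d - segment_integral (P a) c d +
    (segment_integral (Q^~ d) a b - segment_integral (Q^~ c) a b).
Proof.
move=> ab cd H; rewrite /flux (@segment_integralB (P b) (P a)).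
- rewrite (@segment_integralB (Q^~ d) (Q^~ c)) //.
  + by apply: (divergence_free_continuousQ H); rewrite lexx cd.
  + by apply: (divergence_free_continuousQ H); rewrite lexx cd.
- by apply: (divergence_free_continuousP H); rewrite lexx ab.
- by apply: (divergence_free_continuousP H); rewrite lexx ab.
Qed.

Lemma flux_splitx P Q a b c d m : divergence_free P Q a b c d -> c <= d -> a <= m <= b ->
  flux P Q a b c d = flux P Q a m c d + flux P Q m b c d.
Proof.
move=> H cd /[dup] amb /andP[am mb].
rewrite !fluxE ?(le_trans am) //; try by apply: divergence_free_sub H _ _ _ _.
rewrite (@segment_integral_split (Q^~ d) a b m) ?(@segment_integral_split (Q^~ c) a b m) //.
- lra.
- by apply: (divergence_free_continuousQ H); rewrite lexx cd.
- by apply: (divergence_free_continuousQ H); rewrite lexx cd.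
Qed.

Lemma flux_splity P Q a b c d m : divergence_free P Q a b c d -> a <= b -> c <= m <= d ->
  flux P Q a b c d = flux P Q a b c m + flux P Q a b m d.
Proof.
move=> H ab /[dup] cmd /andP[cm md].
rewrite !fluxE ?(le_trans cm) //; try by apply: divergence_free_sub H _ _ _ _.
rewrite (@segment_integral_split (P b) c d m) ?(@segment_integral_split (P a) c d m) //.
- lra.
- by apply: (divergence_free_continuousP H); rewrite lexx ab.
- by apply: (divergence_free_continuousP H); rewrite lexx ab.
Qed.

(** The affine parts of [P] and [Q] contribute opposite multiples of the area. Each integrand is a
    difference of two remainders, each at most [e / 2] times the half-perimeter, which gives the
    square after integration. *)
Lemma flux_small P Q x0 y0 e : divergence_free_at P Q x0 y0 -> 0 < e ->
  exists2 r, 0 < r & forall a b c d, a <= x0 <= b -> c <= y0 <= d ->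
    b - a <= r -> d - c <= r -> divergence_free P Q a b c d ->
    `|flux P Q a b c d| <= e * (b - a + (d - c)) ^+ 2.
Proof.
move=> [A [B [D H]]] e0; have e20 : 0 < e / 2 by rewrite divr_gt0.
have [r r0 Hr] := H _ e20; exists r => // a b c d /andP[ax xb] /andP[cy yd] ba dc PQ.
have ab : a <= b by exact: le_trans xb.
have cd : c <= d by exact: le_trans yd.
have Hx x y : a <= x <= b -> c <= y <= d ->
    `|P x y - P x0 y0 - (A * (x - x0) + B * (y - y0))| <= e / 2 * (b - a + (d - c)) /\
    `|Q x y - Q x0 y0 - (D * (x - x0) - A * (y - y0))| <= e / 2 * (b - a + (d - c)).
  move=> /andP[ax' xb'] /andP[cy' yd'].
  have xx0 : `|x - x0| <= b - a by rewrite ler_norml; apply/andP; split; lra.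
  have yy0 : `|y - y0| <= d - c by rewrite ler_norml; apply/andP; split; lra.
  have [H1 H2] := Hr x y (le_trans xx0 ba) (le_trans yy0 dc).
  have le2 : e / 2 * (`|x - x0| + `|y - y0|) <= e / 2 * (b - a + (d - c)).
    by rewrite ler_wpM2l ?(ltW e20) // lerD.
  by split; [exact: le_trans H1 _|exact: le_trans H2 _].
set s := b - a + (d - c) in Hx *.
have HP : `|segment_integral (fun y => P b y - P a y) c d - A * (b - a) * (d - c)| <= e * s * (d - c).
  apply: segment_integral_approx => // [y cyd|y cyd].
    apply: continuousB; apply: (divergence_free_continuousP PQ _ cyd) => //.
      by rewrite lexx ab.
    by rewrite lexx ab.
  have [|H1 _] := Hx b y _ cyd; first by rewrite lexx ab.
  have [|H2 _] := Hx a y _ cyd; first by rewrite lexx ab.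
  rewrite (_ : _ - _ = (P b y - P x0 y0 - (A * (b - x0) + B * (y - y0))) -
    (P a y - P x0 y0 - (A * (a - x0) + B * (y - y0)))); last by ring.
  by apply: le_trans (ler_normB _ _) _; lra.
have HQ : `|segment_integral (fun x => Q x d - Q x c) a b - - A * (d - c) * (b - a)| <= e * s * (b - a).
  apply: segment_integral_approx => // [x axb|x axb].
    apply: continuousB; apply: (divergence_free_continuousQ PQ _ axb) => //.
      by rewrite lexx cd.
    by rewrite lexx cd.
  have [|_ H1] := Hx x d axb; first by rewrite lexx cd.
  have [|_ H2] := Hx x c axb; first by rewrite lexx cd.
  rewrite (_ : _ - _ = (Q x d - Q x0 y0 - (D * (x - x0) - A * (d - y0))) -
    (Q x c - Q x0 y0 - (D * (x - x0) - A * (c - y0)))); last by ring.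
  by apply: le_trans (ler_normB _ _) _; lra.
rewrite /flux; set I := segment_integral _ c d in HP *; set J := segment_integral _ a b in HQ *.
rewrite (_ : I + J = (I - A * (b - a) * (d - c)) + (J - - A * (d - c) * (b - a))); last by ring.
apply: le_trans (ler_normD _ _) _; apply: le_trans (lerD HP HQ) _.
by rewrite -mulrDr [X in _ * X]addrC -/s -mulrA -expr2.
Qed.

Lemma nested_segments (a b : nat -> R) : {homo a : n m / (n <= m)%N >-> n <= m} ->
  {homo b : n m / (n <= m)%N >-> m <= n} -> (forall n, a n <= b n) ->
  exists x, forall n, a n <= x <= b n.
Proof.
move=> amono bmono ab.
have abn n m : a n <= b m.
  apply: le_trans (amono _ _ (leq_maxl n m)) _.
  by apply: le_trans (ab _) (bmono _ _ (leq_maxr n m)).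
exists (sup (range a)) => n; apply/andP; split.
  by apply: ub_le_sup; [exists (b 0%N) => _ [m _ <-]|exists n].
by apply: ge_sup; [exists (a n), n|move=> _ [m _ <-]].
Qed.

(** The rectangle with sides [[a, b]] and [[c, d]] is stored as [((a, b), (c, d))]. *)
Let rect := (R * R * (R * R))%type.

Let excess P Q (k : R) (r : rect) :=
  [/\ r.1.1 <= r.1.2, r.2.1 <= r.2.2, divergence_free P Q r.1.1 r.1.2 r.2.1 r.2.2 &
    k * (r.1.2 - r.1.1) * (r.2.2 - r.2.1) <= `|flux P Q r.1.1 r.1.2 r.2.1 r.2.2|].

Let half_of (r r' : rect) :=
  [/\ r.1.1 <= r'.1.1 /\ r'.1.2 <= r.1.2, r.2.1 <= r'.2.1 /\ r'.2.2 <= r.2.2,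
      r'.1.2 - r'.1.1 = (r.1.2 - r.1.1) / 2 & r'.2.2 - r'.2.1 = (r.2.2 - r.2.1) / 2].

(** Flux and area are additive over the four quarters, so the flux cannot fall below [k] times the
    area on all of them. *)
Lemma excess_half P Q k r : excess P Q k r -> exists r', excess P Q k r' /\ half_of r r'.
Proof.
case: r => [[a b] [c d]] [/= ab cd PQ fl].
pose m := (a + b) / 2; pose n := (c + d) / 2.
have am : a <= m by rewrite /m; lra.
have mb : m <= b by rewrite /m; lra.
have cn : c <= n by rewrite /n; lra.
have nd : n <= d by rewrite /n; lra.
have amb : a <= m <= b by rewrite am.
have cnd : c <= n <= d by rewrite cn.
have PQ1 := divergence_free_sub PQ (lexx a) mb (lexx c) (lexx d).
have PQ2 := divergence_free_sub PQ am (lexx b) (lexx c) (lexx d).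
rewrite (flux_splitx PQ cd amb) (flux_splity PQ1 am cnd) (flux_splity PQ2 mb cnd) in fl.
have [H1|H1] := leP (k * (m - a) * (n - c)) `|flux P Q a m c n|.
  exists (a, m, (c, n)); split; split=> //=; try (by rewrite /m /n; lra).
  by apply: divergence_free_sub PQ _ _ _ _.
have [H2|H2] := leP (k * (m - a) * (d - n)) `|flux P Q a m n d|.
  exists (a, m, (n, d)); split; split=> //=; try (by rewrite /m /n; lra).
  by apply: divergence_free_sub PQ _ _ _ _.
have [H3|H3] := leP (k * (b - m) * (n - c)) `|flux P Q m b c n|.
  exists (m, b, (c, n)); split; split=> //=; try (by rewrite /m /n; lra).
  by apply: divergence_free_sub PQ _ _ _ _.
have [H4|H4] := leP (k * (b - m) * (d - n)) `|flux P Q m b n d|.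
  exists (m, b, (n, d)); split; split=> //=; try (by rewrite /m /n; lra).
  by apply: divergence_free_sub PQ _ _ _ _.
suff : `|flux P Q a m c n + flux P Q a m n d + (flux P Q m b c n + flux P Q m b n d)| <
    k * (b - a) * (d - c) by rewrite ltNge fl.
have N1 := ler_normD (flux P Q a m c n + flux P Q a m n d) (flux P Q m b c n + flux P Q m b n d).
have N2 := ler_normD (flux P Q a m c n) (flux P Q a m n d).
have N3 := ler_normD (flux P Q m b c n) (flux P Q m b n d).
have E : k * (b - a) * (d - c) = k * (m - a) * (n - c) + k * (m - a) * (d - n) +
    (k * (b - m) * (n - c) + k * (b - m) * (d - n)) by ring.
by rewrite E; lra.
Qed.

(** If the flux were nonzero, repeated bisection would give rectangles shrinking to a point with
    flux per area at least [k], against [flux_small] at that point. *)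
Theorem goursat P Q a b c d : a < b -> c < d -> divergence_free P Q a b c d ->
  flux P Q a b c d = 0.
Proof.
move=> ab cd PQ; apply/eqP; rewrite -normr_eq0; apply: contraT => f0.
have {}f0 : 0 < `|flux P Q a b c d| by rewrite lt_neqAle eq_sym f0 /=.
pose w := b - a; pose h := d - c.
have w0 : 0 < w by rewrite subr_gt0.
have h0 : 0 < h by rewrite subr_gt0.
pose k := `|flux P Q a b c d| / (w * h).
have k0 : 0 < k by rewrite divr_gt0 // mulr_gt0.
have /choice[F HF] : forall r : rect, exists r', excess P Q k r ->
    excess P Q k r' /\ half_of r r'.
  move=> r; have [/excess_half[r' Hr']|nr] := pselect (excess P Q k r); first by exists r'.
  by exists r => /nr.
pose r n := iter n F (a, b, (c, d)).
have er n : excess P Q k (r n).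
  elim: n => [|n IH]; last by have [] := HF _ IH.
  split=> //=; try exact: ltW.
  by rewrite -/w -/h /k -mulrA divfK // mulf_neq0 ?gt_eqF.
have hr n : half_of (r n) (r n.+1) by have [] := HF _ (er n).
have wr n : (r n).1.2 - (r n).1.1 = w / 2 ^+ n.
  elim: n => [|n IH]; first by rewrite expr0 divr1.
  by have [_ _ -> _] := hr n; rewrite IH exprSr invfM mulrA.
have hhr n : (r n).2.2 - (r n).2.1 = h / 2 ^+ n.
  elim: n => [|n IH]; first by rewrite expr0 divr1.
  by have [_ _ _ ->] := hr n; rewrite IH exprSr invfM mulrA.
have [||n|x Hx] := @nested_segments (fun n => (r n).1.1) (fun n => (r n).1.2).
- by apply: homo_leq => [//|n m p|n]; [exact: le_trans|have [[]] := hr n].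
- by apply: homo_leq => [//|n m p H1 H2|n]; [exact: le_trans H2 H1|have [[]] := hr n].
- by have [] := er n.
have [||n|y Hy] := @nested_segments (fun n => (r n).2.1) (fun n => (r n).2.2).
- by apply: homo_leq => [//|n m p|n]; [exact: le_trans|have [_ []] := hr n].
- by apply: homo_leq => [//|n m p H1 H2|n]; [exact: le_trans H2 H1|have [_ []] := hr n].
- by have [] := er n.
(* With this tolerance [flux_small] bounds the flux by half of [k] times the area, at every level of
   the bisection. *)
have e0 : 0 < k * w * h / (2 * (w + h) ^+ 2).
  rewrite divr_gt0 //; first exact: mulr_gt0 (mulr_gt0 k0 w0) h0.
  by apply: mulr_gt0 => //; apply: exprn_gt0; apply: addr_gt0.
have [s s0 Hs] := flux_small (PQ x y (Hx 0%N) (Hy 0%N)) e0.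
pose n := Num.truncn ((w + h) / s).
have p0 : 0 < 2 ^+ n.+1 :> R by rewrite exprn_gt0.
have ns : (w + h) / 2 ^+ n.+1 <= s.
  rewrite ler_pdivrMr // mulrC -ler_pdivrMr //.
  apply: le_trans (ltW (truncnS_gt _)) _; rewrite -/n -natrX ler_nat.
  exact/ltnW/ltn_expl.
have [a1 c1 PQ1] := er n.+1; rewrite wr hhr => fn.
have := Hs _ _ _ _ (Hx n.+1) (Hy n.+1); rewrite wr hhr.
have ws : w / 2 ^+ n.+1 <= s.
  by apply: le_trans ns; rewrite ler_pM2r ?invr_gt0 // lerDl ltW.
have hs : h / 2 ^+ n.+1 <= s.
  by apply: le_trans ns; rewrite ler_pM2r ?invr_gt0 // lerDr ltW.
move=> /(_ ws hs PQ1) /(le_trans fn).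
set q := 2 ^+ n.+1 in p0 *.
have -> : k * w * h / (2 * (w + h) ^+ 2) * (w / q + h / q) ^+ 2 = k * (w / q) * (h / q) / 2.
  by field; rewrite !gt_eqF // addr_gt0.
have := mulr_gt0 (mulr_gt0 k0 (divr_gt0 w0 p0)) (divr_gt0 h0 p0).
lra.
Qed.

End Goursat.

(** * The Cauchy estimate *)

Section ComplexExponential.
Context {R : realType}.
Notation C := (R[i] : numFieldType).
Local Open Scope complex_scope.
Implicit Types (z w h : R[i]) (x y : R).

Lemma norm_real_complex x : `|x%:C| = `|x|%:C.
Proof. exact: (@norm_emb _ _ (complex_real_scalars R)). Qed.

Lemma norm_complexi : `|'i%C : R[i]| = 1.
Proof. by rewrite normc_def /= expr0n expr1n add0r sqrtr1. Qed.

Lemma norm_complex_le z : `|z| <= (`|complex.Re z| + `|complex.Im z|)%:C.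
Proof.
rewrite {1}[z]complexE; apply: le_trans (ler_normD _ _) _.
by rewrite normrM norm_complexi mul1r !norm_real_complex -rmorphD.
Qed.

Lemma norm_Im_le z : `|complex.Im z|%:C <= `|z|.
Proof.
have := normc_ge_Re (z * 'i%C).
by rewrite ReiNIm normrN normrM norm_complexi mulr1.
Qed.

Definition cexp z : R[i] := (expR (complex.Re z))%:C * (cos (complex.Im z) +i* sin (complex.Im z)).

Lemma cexpD z w : cexp (z + w) = cexp z * cexp w.
Proof.
rewrite /cexp; case: z w => [x y] [x' y'] /=; rewrite expRD cosD sinD rmorphM /=.
by apply/eqP; rewrite eq_complex /=; apply/andP; split; apply/eqP; ring.
Qed.

Lemma norm_cexp z : `|cexp z| = (expR (complex.Re z))%:C.
Proof.
rewrite normrM norm_real_complex (ger0_norm (expR_ge0 _)).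
by rewrite normc_def /= cos2Dsin2 sqrtr1 mulr1.
Qed.

Lemma cexp_neq0 z : cexp z != 0.
Proof. by rewrite -normr_eq0 norm_cexp (inj_eq (@complexI R)) gt_eqF ?expR_gt0. Qed.

Lemma cexp_2pi x : cexp (x +i* (pi *+ 2)) = cexp x%:C.
Proof. by rewrite /cexp /= cos2pi sin2pi cos0 sin0. Qed.

Lemma real_derive_near_le (f : R -> R) (t a e : R) : is_derive t 1 f a -> 0 < e ->
  \forall s \near t, `|f s - f t - (s - t) * a| <= e * `|s - t|.
Proof.
by move=> fd e0; have := derivable_near_le (@ex_derive _ _ _ _ _ _ _ fd) e0; rewrite derive_val.
Qed.

Lemma expR_norm_near0 (e : R) : 0 < e -> \forall x \near (0 : R),
  `|expR x - 1 - x| <= e * `|x| /\ `|expR x - 1| <= e /\ `|expR x| <= 2.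
Proof.
move=> e0; have := real_derive_near_le (is_derive_expR (0 : R)) e0; rewrite expR0.
have := proj1 (cvgrPdist_le (FF := nbhs_filter (0 : R)) _ _) (@continuous_expR R 0).
rewrite expR0 => H.
have m0 : 0 < Num.min e 1 by rewrite lt_min e0 ltr01.
move: H => /(_ _ m0); apply: filterS2 => x; rewrite le_min => /andP[H1 H2].
rewrite subr0 mulr1 => H3; split=> //; rewrite distrC; split=> //.
rewrite -[expR x](subrK 1); apply: le_trans (ler_normD _ _) _.
by rewrite normr1 distrC (natrD _ 1 1) lerD.
Qed.

Lemma cexp_near0 (e : R) : 0 < e -> \forall h \near (0 : C),
  (* The real and imaginary errors together are at most [5 * k] times the sum of the moduli of [x]
     and [y], and each of these is at most the modulus of [h]; hence the divisor 10. *)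
  `|cexp h - 1 - h| <= e%:C * `|h|.
Proof.
move=> e0; pose k := e / 10.
have k0 : 0 < k by rewrite divr_gt0.
have := expR_norm_near0 k0; have := real_derive_near_le (is_derive_cos (0 : R)) k0.
have := real_derive_near_le (is_derive_sin (0 : R)) k0.
rewrite cos0 sin0 oppr0 => /nbhs_ballP[r1 /= r10 H1] /nbhs_ballP[r2 /= r20 H2] /nbhs_ballP[r3 /= r30 H3].
pose r := Num.min r1 (Num.min r2 r3).
have r0 : 0 < r%:C by rewrite ltcR !lt_min r10 r20 r30.
apply/nbhs_ballP; exists r%:C => // h; rewrite /ball /= sub0r normrN => hr.
have hR : `|complex.Re h| < r by rewrite -ltcR; exact: le_lt_trans (normc_ge_Re h) hr.
have hI' := norm_Im_le h.
have hI : `|complex.Im h| < r by rewrite -ltcR; exact: le_lt_trans hr.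
have hR' := normc_ge_Re h.
move: hR hI hR' hI'; set x := complex.Re h; set y := complex.Im h.
rewrite !lt_min => /andP[_ /andP[_ x3]] /andP[y1 /andP[y2 _]] xh yh.
have B (l t : R) : `|t| < l -> ball (0 : R) l t by rewrite /ball /= sub0r normrN.
have [E1 [E2 E3]] := H3 _ (B _ _ x3).
have := H1 _ (B _ _ y1); have := H2 _ (B _ _ y2); rewrite !addr0 mulr1 mulr0 subr0 => E4 E5.
apply: le_trans (norm_complex_le _) _.
have -> : complex.Re (cexp h - 1 - h) = expR x * (cos y - 1) + (expR x - 1 - x).
  by rewrite /cexp /x /y; case: (h) => a b /=; ring.
have -> : complex.Im (cexp h - 1 - h) = expR x * (sin y - y) + (expR x - 1) * y.
  by rewrite /cexp /x /y; case: (h) => a b /=; ring.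
apply: le_trans (_ : (5 * k * `|x| + 5 * k * `|y|)%:C <= _).
  rewrite lecR.
  have N1 : `|expR x * (cos y - 1)| <= 2 * (k * `|y|) by rewrite normrM ler_pM.
  have N2 : `|expR x * (sin y - y)| <= 2 * (k * `|y|) by rewrite normrM ler_pM.
  have N3 : `|(expR x - 1) * y| <= k * `|y| by rewrite normrM ler_pM.
  have N4 := ler_normD (expR x * (cos y - 1)) (expR x - 1 - x).
  have N5 := ler_normD (expR x * (sin y - y)) ((expR x - 1) * y).
  have N6 : 0 <= k * `|y| by rewrite mulr_ge0 // ltW.
  have N7 : 0 <= k * `|x| by rewrite mulr_ge0 // ltW.
  lra.
have kE : 10 * k = e by rewrite /k mulrC divfK.
rewrite -kE; apply: le_trans (_ : (5 * k)%:C * (`|x|%:C + `|y|%:C) <= _).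
  by rewrite -rmorphD -rmorphM lecR; lra.
have -> : (10 * k)%:C * `|h| = (5 * k)%:C * (`|h| + `|h|).
  by rewrite (_ : 10 * k = 5 * k + 5 * k) ?rmorphD ?mulrDl ?mulrDr //; ring.
by rewrite ler_wpM2l ?lerD // lecR; lra.
Qed.

Lemma is_derive_cexp z : is_derive (z : C) 1 (cexp : C -> C) (cexp z).
Proof.
apply: near_is_derive => e e0.
have [e'0 eE] := @emb_re_gt0 _ _ (complex_real_scalars R) e e0.
rewrite /= in e'0 eE.
pose k := complex.Re e / expR (complex.Re z).
have k0 : 0 < k by rewrite divr_gt0 ?expR_gt0.
rewrite (near_shift (0 : C)); apply: filterS (cexp_near0 k0) => h /=.
rewrite subr0 addrK cexpD => H.
rewrite (_ : _ - _ = (cexp h - 1 - h) * cexp z); last by ring.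
rewrite normrM norm_cexp -eE mulrC -ler_pdivlMl ?ltcR ?expR_gt0 //.
apply: le_trans H _; rewrite /k rmorphM fmorphV /= mulrA [(expR _)%:C^-1 * _]mulrC.
by [].
Qed.

End ComplexExponential.

Section CauchyEstimate.
Context {R : realType}.
Notation C := (R[i] : numFieldType).
Local Open Scope complex_scope.
Implicit Types (g : C -> C) (z w h : R[i]) (x y : R).

Lemma complex_gt0 (e : C) : 0 < e -> 0 < complex.Re e /\ (complex.Re e)%:C = e.
Proof. exact: (@emb_re_gt0 _ _ (complex_real_scalars R)). Qed.

(* The Cauchy-Riemann equations make the divergence of (Re g, - Im g) vanish. *)
Lemma derivable_divergence_free g x0 y0 : derivable g (x0 +i* y0) 1 ->
  divergence_free_at (fun x y => complex.Re (g (x +i* y)))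
    (fun x y => - complex.Im (g (x +i* y))) x0 y0.
Proof.
move=> dg; pose l := 'D_1 g (x0 +i* y0).
exists (complex.Re l), (- complex.Im l), (- complex.Im l) => e e0.
have e'0 : 0 < e%:C by rewrite ltcR.
have /nbhs_ballP[r /= r0 Hr] := derivable_near_le dg e'0.
have [r'0 rE] := complex_gt0 r0.
exists (complex.Re r / 3) => [|x y xr yr]; first by rewrite divr_gt0.
have dE : (x +i* y) - (x0 +i* y0) = (x - x0) +i* (y - y0) by [].
have nd := norm_complex_le ((x - x0) +i* (y - y0)); rewrite /= in nd.
have /Hr : ball (x0 +i* y0 : C) r (x +i* y).
  rewrite /ball /= distrC dE -rE; apply: le_lt_trans nd _; rewrite ltcR; lra.
rewrite dE -/l => {}Hr.
have {}Hr : `|g (x +i* y) - g (x0 +i* y0) - ((x - x0) +i* (y - y0)) * l| <=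
    (e * (`|x - x0| + `|y - y0|))%:C.
  by apply: le_trans Hr _; rewrite rmorphM ler_wpM2l ?(ltW e'0).
split; rewrite -lecR.
  apply: le_trans Hr; apply: le_trans (normc_ge_Re _).
  rewrite lecR; case: (g _) (g _) (l) => [a1 a2] [b1 b2] [l1 l2] /=.
  by rewrite le_eqVlt; apply/orP; left; apply/eqP; congr (`|_|); ring.
apply: le_trans Hr; apply: le_trans (norm_Im_le _).
rewrite lecR -normrN; case: (g _) (g _) (l) => [a1 a2] [b1 b2] [l1 l2] /=.
by rewrite le_eqVlt; apply/orP; left; apply/eqP; congr (`|_|); ring.
Qed.

(** The real part of [H] has the same mean over both vertical sides: at most [M / r] on the side
    that [cexp] wraps onto the circle of radius [r], and within [e] of [L] on the side wrapped onto
    a small circle. *)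
Lemma cauchy_estimate g (r M : R) : 0 < r ->
  (forall z, `|z| <= r%:C -> derivable g z 1) ->
  (forall z, `|z| <= r%:C -> `|g z - g 0| <= M%:C) ->
  `|'D_1 g 0| <= (M / r)%:C.
Proof.
move=> r0 dg gM; set l := 'D_1 g 0.
(* Rotating [l] to its modulus lets the real part alone carry the estimate. *)
have [c nc cl] : exists2 c : C, `|c| = 1 & c * l = `|l|.
  have [->|l0] := eqVneq l 0; first by exists 1; rewrite ?normr1 // mulr0 normr0.
  by exists (`|l| / l); rewrite ?divfK // normrM normfV normr_id divff // normr_eq0.
have lE : `|l| = (complex.Re `|l|)%:C by rewrite RRe_real // normr_real.
set L := complex.Re `|l| in lE; rewrite lE lecR.
apply/ler_addgt0Pr => e e0.
have e'0 : 0 < e%:C by rewrite ltcR.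
have dg0 : derivable g 0 1 by apply: dg; rewrite normr0 lecR ltW.
have /nbhs_ballP[d /= d0 Hd] := derivable_near_le dg0 e'0.
have [d'0 dE] := complex_gt0 d0.
(* The term [b - 1] ensures [a < b]; the other puts the inner circle inside the disc where [Hd]
   applies. *)
pose b := ln r; pose a := Num.min (b - 1) (ln (complex.Re d / 2)).
have eb : expR b = r by rewrite lnK.
have ea : expR a <= complex.Re d / 2.
  by rewrite -[leRHS]lnK ?posrE ?divr_gt0 // ler_expR ge_min lexx orbT.
have ab : a < b by rewrite gt_min ltrBlDr ltrDl ltr01.
pose H (w : C) : C := c * (g (cexp w) - g 0) * (cexp w)^-1.
have nz x y : `|cexp (x +i* y)| = (expR x)%:C by rewrite norm_cexp.
have dH x y : x <= b -> derivable H (x +i* y) 1.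
  move=> xb.
  have dE1 : derivable (cexp : C -> C) (x +i* y) 1 by apply: ex_derive; exact: is_derive_cexp.
  have dg1 : derivable g (cexp (x +i* y)) 1.
    by apply: dg; rewrite nz lecR -eb ler_expR.
  pose h1 : C -> C := g \o cexp; pose h2 : C -> C := cexp.
  have -> : H = (cst c * (h1 - cst (g 0)) * (fun w => (h2 w)^-1) : C -> C) by [].
  apply: derivableM; last exact: derivableV (cexp_neq0 _) dE1.
  apply: derivableM; first exact: derivable_cst.
  apply: derivableB; last exact: derivable_cst.
  have dE2 := proj1 (derivable1_diffP _ _) dE1.
  have dg2 := proj1 (derivable1_diffP _ _) dg1.
  apply/derivable1_diffP.
  exact: (differentiable_comp dE2 dg2).
(* By periodicity the horizontal sides of the rectangle do not contribute to the
   flux, so the integral over a vertical side does not depend on that side. *)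
pose P x y := complex.Re (H (x +i* y)); pose Q x y := - complex.Im (H (x +i* y)).
have PQ : divergence_free P Q a b 0 (pi *+ 2).
  by move=> x y /andP[_ xb] _; apply: derivable_divergence_free; exact: dH.
have pi0 : 0 < (pi *+ 2 : R) by rewrite pmulrn_lgt0 // pi_gt0.
have fl := goursat ab pi0 PQ.
have Pc x : a <= x <= b -> continuous_on_segment (P x) 0 (pi *+ 2).
  exact: divergence_free_continuousP PQ.
have aab : a <= a <= b by rewrite lexx ltW.
have abb : a <= b <= b by rewrite lexx ltW.
have E : segment_integral (P b) 0 (pi *+ 2) = segment_integral (P a) 0 (pi *+ 2).
  apply/eqP; rewrite -subr_eq0 -segment_integralB; [|exact: Pc|exact: Pc].
  move: fl; rewrite /flux [X in _ + X](_ : _ = 0) ?addr0 => [->//|].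
  rewrite -[RHS](mul0r (b - a)) -segment_integral_cst ?ltW //; congr segment_integral.
  by apply/funext => x; rewrite /Q /H cexp_2pi subrr.
have Ib : `|segment_integral (P b) 0 (pi *+ 2) - 0 * (pi *+ 2 - 0)| <= M / r * (pi *+ 2 - 0).
  apply: segment_integral_approx; [exact: ltW|exact: Pc|move=> y _].
  rewrite subr0 -lecR; apply: le_trans (normc_ge_Re _) _.
  have -> : `|H (b +i* y)| = `|g (cexp (b +i* y)) - g 0| / r%:C.
    by rewrite /H normrM normfV nz eb normrM nc mul1r.
  have rC : 0 < r%:C by rewrite ltcR.
  have ME : (M / r)%:C * r%:C = M%:C.
    by rewrite -(rmorphM (real_complex R)) divfK // gt_eqF.
  rewrite (ler_pdivrMr _ _ rC).
  rewrite ME.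
  by apply: gM; rewrite nz eb.
have Ia : `|segment_integral (P a) 0 (pi *+ 2) - L * (pi *+ 2 - 0)| <= e * (pi *+ 2 - 0).
  apply: segment_integral_approx; [exact: ltW|exact: Pc|move=> y _].
  rewrite -lecR; set z := cexp (a +i* y).
  have z0 : z != 0 := cexp_neq0 _.
  have -> : P a y - L = complex.Re (c * (g z - g 0 - (z - 0) * l) / z).
    rewrite /P /H -/z.
    have -> : c * (g z - g 0 - (z - 0) * l) / z = c * (g z - g 0) / z - L%:C.
      by rewrite -lE -cl; field.
    by case: (c * _ / z) => u v /=.
  apply: le_trans (normc_ge_Re _) _.
  have zn : 0 < `|z| by rewrite normr_gt0.
  have -> : `|c * (g z - g 0 - (z - 0) * l) / z| = `|g z - g 0 - (z - 0) * l| / `|z|.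
    by rewrite normrM normfV normrM nc mul1r.
  rewrite (ler_pdivrMr _ _ zn) -[in X in _ <= X](subr0 z).
  apply: Hd; rewrite /ball /= sub0r normrN nz -dE ltcR.
  by clear - ea d'0; lra.
move: Ia Ib; rewrite E mul0r !subr0 ler_norml => /andP[H1 _] /ler_normlW H2.
rewrite -(ler_pM2r pi0) mulrDl.
move: H1 H2; move: (M / r) (pi *+ 2) (L) (e) (segment_integral _ _ _) => q p L' e' I.
by clear; lra.
Qed.

End CauchyEstimate.

(** * Smooth maps are strictly differentiable *)

Lemma line_continuous (K : numFieldType) (V : normedModType K) (y v : V) :
  continuous (fun t : K => y + t *: v).
Proof.
move=> t; apply: (proj2 (cvgrPdist_le (FF := nbhs_filter t) _ _)) => e e0.
have v0 : 0 < `|v| + 1 by rewrite ltr_wpDl.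
have r0 : 0 < e / (`|v| + 1) by rewrite divr_gt0.
apply: filterS (nbhsx_ballx t _ r0) => s; rewrite -ball_normE /= => ts.
rewrite [y + _]addrC addrKA -scalerBl normrZ.
apply: le_trans (_ : `|t - s| * (`|v| + 1) <= _); first by rewrite ler_wpM2l // lerDl.
by rewrite -ler_pdivlMr // ltW.
Qed.

Lemma line_is_derive (K : numFieldType) m n (f : 'rV[K]_m -> 'rV[K]_n)
    (A : 'M[K]_(m, n)) (y v : 'rV[K]_m) (j : 'I_n) (t : K) :
  differentiable f (y + t *: v) ->
  is_derive t 1 (fun s => (f (y + s *: v) - (y + s *: v) *m A) 0 j)
    ((v *m 'J f (y + t *: v) - v *m A) 0 j).
Proof.
set w := fun s => y + s *: v; rewrite -/(w t) => df.
apply: near_is_derive => e e0.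
have v0 : 0 < `|v| + 1 by rewrite ltr_wpDl.
have e'0 : 0 < e / (`|v| + 1) by rewrite divr_gt0.
have near_t : \forall s \near t, `|f (w s) - f (w t) - (w s - w t) *m 'J f (w t)|
    <= e / (`|v| + 1) * `|w s - w t|.
  exact: (@line_continuous _ _ y v t _ (jacobian_near_le df e'0)).
apply: filterS near_t => s; rewrite -/(w s).
have wst : w s - w t = (s - t) *: v by rewrite /w opprD addrACA subrr add0r -scalerBl.
move: ('J f (w t)) (f (w s)) (f (w t)) => J fs ft Hs.
have -> : (fs - w s *m A) 0 j - (ft - w t *m A) 0 j - (s - t) * (v *m J - v *m A) 0 j
    = (fs - ft - (w s - w t) *m J) 0 j.
  have wA : (w s - w t) *m A = w s *m A - w t *m A by rewrite mulmxBl.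
  move: wA; rewrite wst -!scalemxAl => /rowP/(_ j).
  move: (v *m J) (v *m A) (w s *m A) (w t *m A) => vJ vA wsA wtA.
  by rewrite !mxE => E; rewrite mulrBr E; ring.
apply: le_trans (mx_coord_le _ 0 j) _; apply: le_trans Hs _.
rewrite wst normrZ mulrCA mulrC ler_wpM2r // mulrAC -mulrA.
by rewrite ler_piMr ?(ltW e0) // ler_pdivrMr // mul1r lerDl.
Qed.

Section Holomorphic.
Context {R : realType} {m n : nat}.
Notation C := (R[i] : numFieldType).
Local Open Scope complex_scope.

(** The Cauchy estimate on the complex line through [y] in direction [v] shows that the derivative
    is continuous at [x]: it is applied to [f] minus its linear part at [x], whose variation near
    [x] is small. *)
Lemma holomorphic_strict (f : 'rV[C]_m -> 'rV[C]_n) (x : 'rV[C]_m) :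
  (\forall y \near x, differentiable f y) -> strictly_differentiable f x.
Proof.
move=> df; apply: (real_scalars_strict (complex_real_scalars R)).
have dfx := nbhs_singleton df.
have := fun e => @jacobian_near_le _ _ _ f x e dfx.
set A := 'J f x; clearbody A => HA e e0.
have e'0 : 0 < e / 8 by rewrite divr_gt0.
have zI B D := @filterI _ (nbhs x) (nbhs_filter x) B D.
have zH := zI _ _ df (HA _ e'0).
have [d /= d0 Hd] := proj1 (nbhs_ballP _ _) zH.
have d20 : 0 < d / 2 by rewrite divr_gt0.
apply: filterS (nbhsx_ballx x _ d20) => y xy.
have d2 : d / 2 < d by rewrite ltr_pdivrMr // ltr_pMr // ltr1n.
have xyd w : `|w| < d / 2 -> ball x d (y + w).
  move=> wd; apply: (@ball_splitr _ _ y); first exact: ball_sym.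
  by rewrite -ball_normE /= opprD addNKr normrN.
have dfy : differentiable f y by rewrite -[y]addr0; have [] := Hd _ (xyd 0 _); rewrite ?normr0 ?divr_gt0.
split=> // v.
have [->|v0] := eqVneq v 0; first by rewrite !mul0mx subrr !normr0 mulr0.
have nv0 : 0 < `|v| by rewrite normr_gt0.
have [rd0 dE] := complex_gt0 d0; have [rv0 vE] := complex_gt0 nv0.
have [re0 eE] := complex_gt0 e0.
set rd := complex.Re d in rd0 dE; set rv := complex.Re `|v| in rv0 vE.
set re := complex.Re e in re0 eE.
(* The variation [2 * (re / 8 * rd)] divided by this radius is exactly [re * rv], and [t *: v] has
   norm at most [d / 4] on the disc. *)
pose r := rd / (4 * rv).
have r0 : 0 < r by rewrite divr_gt0 // mulr_gt0.
have tv (t : C) : `|t| <= r%:C -> `|t *: v| < d / 2.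
  move=> tr; rewrite normrZ -vE; apply: (@le_lt_trans _ _ (r%:C * rv%:C)).
    by rewrite ler_wpM2r // lecR ltW.
  rewrite ltr_pdivlMr // -dE -(rmorph_nat (real_complex R)) -!(rmorphM (real_complex R)) ltcR.
  by rewrite (_ : r * rv * 2 = rd / 2) ?ltr_pdivrMr ?ltr_pMr ?ltr1n // /r; field; rewrite gt_eqF.
apply/mx_norm_leP => [|i j]; first by rewrite mulr_ge0 // ltW.
rewrite ord1 => {i}.
pose g (t : C) : C := (f (y + t *: v) - (y + t *: v) *m A) 0 j.
have gd (t : C) : `|t| <= r%:C -> is_derive t 1 g ((v *m 'J f (y + t *: v) - v *m A) 0 j).
  by move=> tr; apply: line_is_derive; have [] := Hd _ (xyd _ (tv t tr)).
have D1 (t : C) : `|t| <= r%:C -> derivable g t 1 by move=> tr; have [] := gd t tr.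
have t0 : `|0 : C| <= r%:C by rewrite normr0 lecR ltW.
have G (t : C) : `|t| <= r%:C ->
    `|f (y + t *: v) - f x - (y + t *: v - x) *m A| <= (re / 8 * rd)%:C.
  move=> tr; have xw := xyd _ (tv t tr); have [_ Hw] := Hd _ xw.
  have -> : (re / 8 * rd)%:C = e / 8 * d.
    rewrite -[in RHS]eE -[in RHS]dE -[8 in RHS](rmorph_nat (real_complex R)).
    by rewrite -(fmorphV (real_complex R)) -!(rmorphM (real_complex R)).
  apply: le_trans Hw _.
  by rewrite ler_wpM2l ?(ltW e'0) // ltW // distrC; move: xw; rewrite -ball_normE.
have D2 (t : C) : `|t| <= r%:C -> `|g t - g 0| <= (2 * (re / 8 * rd))%:C.
  move=> tr; have Gt := G t tr; have G0 := G 0 t0.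
  have -> : g t - g 0 = ((f (y + t *: v) - f x - (y + t *: v - x) *m A) -
      (f (y + 0 *: v) - f x - (y + 0 *: v - x) *m A)) 0 j.
    rewrite /g !(mulmxBl _ x).
    move: (f (y + t *: v)) (f (y + 0 *: v)) ((y + t *: v) *m A) ((y + 0 *: v) *m A) => X Y Z W.
    by move: (f x) (x *m A) => fx xA; rewrite !mxE; ring.
  apply: le_trans (mx_coord_le _ 0 j) _; apply: le_trans (ler_normB _ _) _.
  rewrite [2 * _]mulr_natl mulr2n (rmorphD (real_complex R)).
  exact: lerD Gt G0.
have H := cauchy_estimate r0 D1 D2.
have gd0 := gd 0 t0; move: H; rewrite derive_val scale0r addr0.
move=> H; apply: le_trans H _.
rewrite -eE -vE -(rmorphM (real_complex R)) lecR le_eqVlt; apply/orP; left; apply/eqP.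
by rewrite /r; field; rewrite !gt_eqF.
Qed.
End Holomorphic.

Lemma C2_strict (R : realType) (K : numFieldType) (S : real_scalars R K) m n
    (Omega : set 'rV[K]_m) (f : 'rV[K]_m -> 'rV[K]_n) (x : 'rV[K]_m) :
  open Omega -> C2_on Omega f -> Omega x -> strictly_differentiable f x.
Proof.
move=> oO C2 Ox; apply: (real_scalars_strict S) => e e0.
have [_ dJ _] := C2 x Ox.
have Jc := differentiable_continuous dJ.
(* The divisor absorbs the factor [m] of [mulmx_norm_le] and is positive also when [m = 0]. *)
have m0 : 0 < e / m.+1%:R by rewrite divr_gt0.
have H1 := proj1 (cvgrPdist_le (FF := nbhs_filter x) _ _) Jc _ m0.
have H2 : \forall y \near x, Omega y by apply: open_nbhs_nbhs.
apply: filterS2 H2 H1 => y Oy; have [dfy _ _] := C2 y Oy.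
move: ('J f x) ('J f y) => Jx Jy HJ; split=> // v.
rewrite -mulmxBr; apply: le_trans (mulmx_norm_le _ _) _.
rewrite distrC in HJ; rewrite mulrAC ler_wpM2r //.
apply: le_trans (ler_wpM2l (ler0n _ _) HJ) _.
rewrite mulrCA ler_piMr ?(ltW e0) // ler_pdivrMr ?ltr0n // mul1r ler_nat.
exact: leqnSn.
Qed.

Theorem lemma3p3 (R : realType) (s : scalar_kind) (m n : nat)
    (Omega : set 'rV[scalars R s]_m)
    (f : 'rV[scalars R s]_m -> 'rV[scalars R s]_n)
    (xs : 'rV[scalars R s]_m) :
  open Omega ->
  smooth_on Omega f ->
  semiregular_zero Omega f xs ->
  exists Delta : set 'rV[scalars R s]_m,
    [/\ open Delta, Delta xs &
        forall x, (Delta `&` zeros Omega f) x ->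
          semiregular_zero Omega f x /\ same_branch Omega f xs x].
Proof.
(* The two cases differ in how strict differentiability at [xs] is obtained: from the continuous
   Jacobian of a [C2_on] map, or from holomorphy. *)
case: s Omega f xs => Omega f xs oO sm sr; have Oxs : Omega xs by case: sr => -[].
- pose S := real_real_scalars R.
  apply: semiregular_zero_neighborhood => //.
  + exact: real_scalars_locally_onto S.
  + exact: real_scalars_connected_balls S.
  + by move=> x /sm[].
  + exact: (C2_strict S oO sm Oxs).
- pose S := complex_real_scalars R.
  apply: semiregular_zero_neighborhood => //.
  + exact: real_scalars_locally_onto S.
  + exact: real_scalars_connected_balls S.
  + apply: holomorphic_strict.
    by apply: filterS (open_nbhs_nbhs (conj oO Oxs)) => x /sm.
Qed.
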